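(* (Spacelike Björling representation.) Let $X:\mathfrak O\subset\mathbb C'\to\mathbb L^3$ be a timelike minimal surface in $\mathbb L^3$ with Gauss map $N$, with conformal coordinates $(t,s)$, regarded as a function of the split-complex variable $w=s+k't$. Set $\gamma(s)=X(0,s)$, $W(s)=N(0,s)$ (values at $t=0$) on a real interval $I$ in $\mathfrak O$. Choose any simply connected region $\mathfrak R\subset\mathfrak O$ containing $I$ over which split-holomorphic extensions $\gamma(w),W(w)$ of $\gamma$ and $W$ can be defined for all $w\in\mathfrak R$. Then for all $w\in\mathfrak R$ $$X(w)=\mathrm{Re}\left(\gamma(w)+k'\int_{s_o}^{w}W(\zeta)\times\gamma'(\zeta)\,d\zeta\right),$$ where $s_o$ is an arbitrary fixed point in $I$ and the path integral is taken over any path in $\mathfrak R$ from $s_o$ to $w$.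
   Context: $\mathbb C'=\{x+k'y: x,y\in\mathbb R\}$ is the commutative real algebra of split-complex numbers, with $k'^2=1$, $\mathrm{Re}(x+k'y)=x$, $\mathrm{Im}(x+k'y)=y$, topologized as $\mathbb R^2$; real numbers are identified with $x+k'0$. A function $f(x+k'y)=u(x,y)+k'v(x,y)$ is split-holomorphic if $u_x=v_y$ and $u_y=v_x$; then $f'=u_x+k'v_x$. Line integrals use $dw=dx+k'dy$. Here the variable is $w=s+k't$ (so $w=k'z$ for $z=t+k's$), and the real interval $I$ consists of points with $t=0$. Extensions of vector-valued functions are taken componentwise. $\mathbb L^3$ is $\mathbb R^3$ with $\langle x,y\rangle=-x_1y_1+x_2y_2+x_3y_3$. The Lorentzian cross product is defined by $\langle u\times v,w\rangle=\det[u,v,w]$ and is extended $\mathbb C'$-bilinearly to $(\mathbb C')^3$. A timelike surface $X$ (defined on a domain) is an immersion inducing a metric of signature $(1,1)$; the conformal coordinates $(t,s)$ satisfy $\langle X_t,X_s\rangle=0$ and $\langle X_s,X_s\rangle=-\langle X_t,X_t\rangle>0$. It is minimal if its mean curvature vanishes, equivalently $X_{tt}=X_{ss}$. The Gauss map $N$ is the unit spacelike normal field, oriented so that $N\times X_t=X_s$ and $N\times X_s=X_t$. Standing assumption: all functions, curves, surfaces and extensions considered are real analytic. *)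

(* Defs.v *)
From HB Require Import structures.
From mathcomp Require Import all_boot all_order all_algebra.
From mathcomp Require Import all_classical all_reals all_analysis.
From mathcomp Require Import ring.

Set Implicit Arguments.
Unset Strict Implicit.
Unset Printing Implicit Defensive.

Import Order.TTheory GRing.Theory Num.Theory.
Import numFieldNormedType.Exports.

Local Open Scope classical_set_scope.
Local Open Scope ring_scope.

(* The pair (x, y) stands for x + k'y.  The alias keeps the product topology
   and the real vector space structure of R * R; its multiplication is the
   split-complex one, not the componentwise one. *)
Definition splitC (R : realType) : Type := (R * R)%type.

HB.instance Definition _ (R : realType) :=
  NormedModule.copy (splitC R) (R * R)%type.

Section SplitComplexRing.
Variable R : realType.
Implicit Types z w : splitC R.

Definition splitRe z : R := z.1.
Definition splitIm z : R := z.2.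
Definition sreal (x : R) : splitC R := (x, 0).
Definition splitk : splitC R := (0, 1).

Definition split_mul z w : splitC R :=
  (z.1 * w.1 + z.2 * w.2, z.1 * w.2 + z.2 * w.1).

Lemma split_mulA : associative split_mul.
Proof.
move=> [a b] [c d] [e f]; rewrite /split_mul /=.
by congr pair; ring.
Qed.

Lemma split_mulC : commutative split_mul.
Proof.
move=> [a b] [c d]; rewrite /split_mul /=.
by congr pair; rewrite ![_ * a]mulrC ![_ * b]mulrC // addrC.
Qed.

Lemma split_mul1 : left_id (sreal 1) split_mul.
Proof. by move=> [a b]; rewrite /split_mul /= !mul1r !mul0r !addr0. Qed.

Lemma split_mulD : left_distributive split_mul +%R.
Proof.
move=> [a b] [c d] [e f]; rewrite /split_mul /=.
by congr pair; rewrite /= !mulrDl addrACA.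
Qed.

Lemma split_1neq0 : sreal 1 != 0.
Proof. by apply/eqP => -[] /eqP; rewrite oner_eq0. Qed.

HB.instance Definition _ := GRing.Zmodule_isComNzRing.Build (splitC R)
  split_mulA split_mulC split_mul1 split_mulD split_1neq0.

Lemma splitk_sqr : splitk * splitk = 1.
Proof. by congr pair; rewrite /= !mul0r !(mulr0, mulr1) ?add0r ?addr0. Qed.

Lemma splitCE z : z = sreal (splitRe z) + splitk * sreal (splitIm z).
Proof.
case: z => x y; congr pair; rewrite /= !mul0r ?mulr0 ?mul1r ?addr0 ?add0r //.
Qed.

End SplitComplexRing.

Arguments splitk {R}.

(* L^3, over any commutative ring A: for A = R these are the Lorentzian
   product and cross product, and for A = splitC R their bilinear extensions. *)
Section Lorentz.
Variable A : comNzRingType.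
Implicit Types u v w : 'rV[A]_3.

Definition lsign (i : 'I_3) : A := if i == ord0 then -1 else 1.

Definition ldot u v : A := \sum_(i < 3) lsign i * u 0 i * v 0 i.

Definition det3 u v w : A := \det (\matrix_(i < 3) nth 0 [:: u; v; w] i).

(* The only vector satisfying ldot_lcross: pair it with the basis vectors. *)
Definition lcross u v : 'rV[A]_3 :=
  \row_i (lsign i * det3 u v (delta_mx 0 i)).

Lemma ldot_lcross u v w : ldot (lcross u v) w = det3 u v w.
Proof.
have E x : det3 u v x = \sum_j x 0 j *
    cofactor (\matrix_(i < 3) nth 0 [:: u; v; 0] i) ord_max j.
  rewrite /det3 (expand_det_row _ ord_max); apply: eq_bigr => j _.
  rewrite mxE; congr (_ * _); rewrite /cofactor; congr (_ * \det _).
  apply/matrixP => a b; rewrite !mxE lift_max.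
  by case: a => [[|[|[]]]].
rewrite /ldot [RHS]E; apply: eq_bigr => i _; rewrite !mxE E (bigD1 i) //=.
rewrite big1 ?addr0 => [|j /negPf ji]; last by rewrite mxE ji mul0r.
rewrite mxE !eqxx mul1r mulrA.
by rewrite -/(lsign i) [RHS]mulrC /lsign; case: ifP; rewrite ?mulrNN !mul1r.
Qed.

End Lorentz.

Section RealAnalytic.
Variable R : realType.

(* Near each point of D, f is the sum of an absolutely convergent double power
   series (square partial sums). *)
Definition real_analytic (D : set (splitC R)) (f : splitC R -> R) : Prop :=
  forall p, D p -> exists (a : nat -> nat -> R) (r : R), 0 < r /\
    forall x y, `|x| < r -> `|y| < r ->
      cvgn (fun n => \sum_(i < n) \sum_(j < n) `|a i j * x ^+ i * y ^+ j|) /\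
      (fun n => \sum_(i < n) \sum_(j < n) a i j * x ^+ i * y ^+ j) @ \oo -->
        f (splitRe p + x, splitIm p + y).

Definition real_analytic_vec (D : set (splitC R))
    (F : splitC R -> 'rV[R]_3) : Prop :=
  forall j, real_analytic D (fun p => F p 0 j).

Definition real_analytic_svec (D : set (splitC R))
    (F : splitC R -> 'rV[splitC R]_3) : Prop :=
  forall j, real_analytic D (fun p => splitRe (F p 0 j)) /\
            real_analytic D (fun p => splitIm (F p 0 j)).

End RealAnalytic.

Section Surfaces.
Variable R : realType.
Implicit Types X N : splitC R -> 'rV[R]_3.

(* The surface parameter is w = s + k't, so s is the first real coordinate and
   t the second one. *)
Definition d_s (V : normedModType R) (f : splitC R -> V) : splitC R -> V :=
  fun w => 'D_(1 : splitC R) f w.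
Definition d_t (V : normedModType R) (f : splitC R -> V) : splitC R -> V :=
  fun w => 'D_(splitk : splitC R) f w.

Definition domain (D : set (splitC R)) : Prop :=
  [/\ D !=set0, open D & connected D].

(* The matrix of dX; its rows are X_t and X_s. *)
Definition jacobian_ts X w : 'M[R]_(2, 3) :=
  \matrix_(i < 2) nth 0 [:: d_t X w; d_s X w] i.

Definition first_form X w : 'M[R]_2 :=
  \matrix_(i, j) ldot (row i (jacobian_ts X w)) (row j (jacobian_ts X w)).

Definition signature11 (g : 'M[R]_2) : Prop :=
  exists2 P : 'M[R]_2, P \in unitmx &
    P *m g *m P^T = diag_mx (\row_j (if j == ord0 then -1 else 1)).

Definition timelike_surface (D : set (splitC R)) X : Prop :=
  [/\ domain D, real_analytic_vec D X &
      forall w, D w ->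
        row_free (jacobian_ts X w) /\ signature11 (first_form X w)].

Definition conformal (D : set (splitC R)) X : Prop :=
  forall w, D w ->
    [/\ ldot (d_t X w) (d_s X w) = 0,
        ldot (d_s X w) (d_s X w) = - ldot (d_t X w) (d_t X w) &
        0 < ldot (d_s X w) (d_s X w)].

Definition gauss_map (D : set (splitC R)) X N : Prop :=
  real_analytic_vec D N /\
  forall w, D w ->
    [/\ ldot (N w) (N w) = 1,
        ldot (N w) (d_t X w) = 0,
        ldot (N w) (d_s X w) = 0,
        lcross (N w) (d_t X w) = d_s X w &
        lcross (N w) (d_s X w) = d_t X w].

(* Half the trace of the second fundamental form with respect to the first. *)
Definition mean_curvature X N (w : splitC R) : R :=
  let E := ldot (d_t X w) (d_t X w) in
  let F := ldot (d_t X w) (d_s X w) in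
  let G := ldot (d_s X w) (d_s X w) in
  let e := ldot (d_t (d_t X) w) (N w) in
  let f := ldot (d_t (d_s X) w) (N w) in
  let g := ldot (d_s (d_s X) w) (N w) in
  (e * G - 2 * f * F + g * E) / (2 * (E * G - F ^+ 2)).

Definition minimal (D : set (splitC R)) X N : Prop :=
  forall w, D w -> mean_curvature X N w = 0.

End Surfaces.

Section SplitHolomorphic.
Variable R : realType.

Definition split_holomorphic (D : set (splitC R))
    (f : splitC R -> splitC R) : Prop :=
  let u := fun w => splitRe (f w) in
  let v := fun w => splitIm (f w) in
  forall w, D w ->
    [/\ derivable u w (1 : splitC R) /\ derivable u w splitk,
        derivable v w (1 : splitC R) /\ derivable v w splitk,
        d_s u w = d_t v w & d_t u w = d_s v w].

Definition split_deriv (f : splitC R -> splitC R) (w : splitC R) : splitC R :=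
  (d_s (fun z => splitRe (f z)) w, d_s (fun z => splitIm (f z)) w).

Definition split_deriv_vec (F : splitC R -> 'rV[splitC R]_3) (w : splitC R) :
    'rV[splitC R]_3 :=
  \row_j split_deriv (fun z => F z 0 j) w.

Definition split_extension (I : set R) (D : set (splitC R))
    (c : R -> 'rV[R]_3) (F : splitC R -> 'rV[splitC R]_3) : Prop :=
  [/\ forall s, I s -> F (sreal s) = map_mx (@sreal R) (c s),
      forall j, split_holomorphic D (fun z => F z 0 j) &
      real_analytic_svec D F].

End SplitHolomorphic.

Section Paths.
Variable R : realType.

Definition simply_connected_region (D : set (splitC R)) : Prop :=
  domain D /\
  forall c : R -> splitC R,
    {within `[0, 1], continuous c} -> c 0 = c 1 ->
    (forall x, x \in `[0, 1] -> D (c x)) ->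
    exists H : R * R -> splitC R,
      [/\ {within `[0, 1] `*` `[0, 1], continuous H},
          forall x y, x \in `[0, 1] -> y \in `[0, 1] -> D (H (x, y)),
          forall x, x \in `[0, 1] -> H (0, x) = c x /\ H (1, x) = c 0 &
          forall y, y \in `[0, 1] -> H (y, 0) = c 0 /\ H (y, 1) = c 0].

Definition nondegenerate_interval (I : set R) : Prop :=
  is_interval I /\ exists a b : R, [/\ I a, I b & a < b].

(* Continuously differentiable up to the end points. *)
Definition C1_arc (x y : R) (c : R -> splitC R) : Prop :=
  exists g : R -> splitC R,
    [/\ forall u, derivable g u 1, continuous (derive1 g) &
        {in `[x, y], c =1 g}].

Definition piecewise_C1 (a b : R) (c : R -> splitC R) : Prop :=
  a < b /\
  exists s : seq R, itv_partition a b s /\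
    forall i, (i < size s)%N ->
      C1_arc (nth a (a :: s) i) (nth a (a :: s) i.+1) c.

Definition path_in (D : set (splitC R)) (a b : R) (c : R -> splitC R)
    (z w : splitC R) : Prop :=
  [/\ piecewise_C1 a b c, forall u, u \in `[a, b] -> D (c u), c a = z & c b = w].

(* The product is the split-complex one, which encodes dw = dx + k'dy; the
   finitely many break points of the path do not matter. *)
Definition line_integral (a b : R) (c : R -> splitC R)
    (f : splitC R -> splitC R) : splitC R :=
  (\int[lebesgue_measure]_(u in `[a, b]) splitRe (f (c u) * derive1 c u),
   \int[lebesgue_measure]_(u in `[a, b]) splitIm (f (c u) * derive1 c u)).

Definition line_integral_vec (a b : R) (c : R -> splitC R)
    (F : splitC R -> 'rV[splitC R]_3) : 'rV[splitC R]_3 :=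
  \row_j line_integral a b c (fun z => F z 0 j).

End Paths.

(* Main.v *)
Require Import Defs.
From HB Require Import structures.
From mathcomp Require Import all_boot all_order all_algebra.
From mathcomp Require Import all_classical all_reals all_analysis.
From mathcomp Require Import measurable_realfun perm ring lra.

(** In the coordinates w = s + k't, conformality and vanishing mean curvature
    give the wave equation X_ss = X_tt: differentiating the conformality
    relations shows that X_tt - X_ss is orthogonal to X_t and X_s, the mean
    curvature is its component along N, and N, X_t, X_s form a basis
    ([minimal_conformal_wave]).  Hence Phi = X_s + k' X_t satisfies the
    split-holomorphic equations.  On the real interval one has N x X_s = X_t,
    so there Phi = gamma' + k' (W x gamma').  Both sides are split-holomorphic,
    and therefore they agree on the whole region ([bjorling_derivative]).
    Taking real parts, X - Re gamma has the differential
    Re (k' (W x gamma') dw), which is integrated along the path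
    ([partition_integral]).

    The identity theorem has two halves, as split-holomorphy alone gives no
    analytic continuation.  Near the interval, the ring morphisms
    x + k'y |-> x + y and x + k'y |-> x - y carry a split-holomorphic function
    to a function that is constant along the null lines of one family, which
    all meet the real axis ([null_proj_transport]); so vanishing on the
    interval implies vanishing on a neighbourhood.  From there, real
    analyticity propagates the vanishing to the connected region
    ([line_analytic_identity]).

    Real analyticity enters through double power series, which are shown to be
    differentiable term by term ([expands_ds], [expands_dt]).  The function
    W x gamma' is a polynomial in such series; instead of multiplying double
    series, one restricts to lines, where analyticity takes the form of
    geometric error bounds for Taylor polynomials ([taylor0]), a form which is
    stable under products ([analytic0M]) and still yields unique continuation
    along segments. *)

Set Implicit Arguments.
Unset Strict Implicit.
Unset Printing Implicit Defensive.

Import Order.TTheory GRing.Theory Num.Theory.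
Import numFieldNormedType.Exports.

Local Open Scope classical_set_scope.
Local Open Scope ring_scope.

(** * Double power series *)

Section PowerSeries.
Variable R : realType.
Implicit Types (a : nat -> nat -> R) (f : splitC R -> R) (p : splitC R).

Lemma lim_norm_le (u : R^nat) (l c B : R) n : u @ \oo --> l ->
  (forall N, (n <= N)%N -> `|u N - c| <= B) -> `|l - c| <= B.
Proof.
move=> ul uB.
have ulc : (fun N => `|u N - c|) @ \oo --> `|l - c|.
  by apply: cvg_norm; apply: cvgB => //; exact: cvg_cst.
rewrite -(cvg_lim _ ulc)//; apply: limr_le; first exact: cvgP ulc.
by near=> N; apply: uB; near: N; exact: nbhs_infty_ge.
Unshelve. all: by end_near. Qed.

Lemma geometric_tail_le (q : R) m n : 0 <= q -> q <= 2^-1 ->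
  \sum_(m <= k < n) q ^+ k <= 2 * q ^+ m.
Proof.
move=> q0 q2; have [nm|/ltnW mn] := leqP n m.
  by rewrite big_geq// mulr_ge0// exprn_ge0.
suff : \sum_(m <= k < n) q ^+ k <= 2 * q ^+ m - 2 * q ^+ n.
  by move=> /le_trans; apply; rewrite gerBl mulr_ge0// exprn_ge0.
elim: n mn => [|n IH]; first by rewrite leqn0 => /eqP ->; rewrite big_geq// subrr.
rewrite leq_eqVlt => /predU1P[->|]; first by rewrite big_geq// subrr.
rewrite ltnS => mn; rewrite big_nat_recr//=.
have := IH mn; have : q ^+ n * q <= q ^+ n * 2^-1 by rewrite ler_wpM2l// exprn_ge0.
rewrite exprSr; lra.
Qed.

Lemma natr_le_exp2 n : n%:R <= 2 ^+ n :> R.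
Proof. by rewrite -natrX ler_nat ltnW// ltn_expl. Qed.

Lemma natr_succ_le_exp2 n : n.+1%:R <= 2 ^+ n :> R.
Proof. by rewrite -natrX ler_nat ltn_expl. Qed.

(** The homogeneous component of degree m.  Summing by degree rather than over
    squares has the advantage that the derivative of a partial sum is again a
    partial sum of the derived series. *)
Definition homog a m (x y : R) : R :=
  \sum_(i < m.+1) a i (m - i)%N * x ^+ i * y ^+ (m - i).

Definition coef_bound a (M K : R) : Prop :=
  [/\ 0 <= M, 0 < K & forall i j, `|a i j| <= M * K ^+ (i + j)].

(** The radius 1 / (8 K) is well inside the domain where a coefficient bound
    M K ^ (i + j) forces convergence, so all the tails met below are dominated
    by geometric series of ratio at most 1 / 2. *)
Definition expands f p a M K : Prop :=
  coef_bound a M K /\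
  forall x y, K * `|x| <= 8^-1 -> K * `|y| <= 8^-1 ->
    (fun n => \sum_(m < n) homog a m x y) @ \oo --> f (p.1 + x, p.2 + y).

Lemma term_le a M K i j (x y h : R) : coef_bound a M K ->
  `|x| <= h -> `|y| <= h ->
  `|a i j * x ^+ i * y ^+ j| <= M * (K * h) ^+ (i + j).
Proof.
move=> [M0 K0 aMK] xh yh; rewrite !normrM !normrX exprMn mulrA -mulrA.
rewrite ler_pM ?mulr_ge0 ?exprn_ge0//; rewrite exprD.
by rewrite ler_pM ?exprn_ge0// lerXn2r// nnegrE ?(le_trans _ xh).
Qed.

Lemma homog_le a M K m (x y h : R) : coef_bound a M K ->
  `|x| <= h -> `|y| <= h -> `|homog a m x y| <= M * (2 * (K * h)) ^+ m.
Proof.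
move=> aMK xh yh; apply: (le_trans (ler_norm_sum _ _ _)).
have [M0 K0 _] := aMK; have h0 : 0 <= h by exact: le_trans xh.
apply: (@le_trans _ _ (\sum_(i < m.+1) M * (K * h) ^+ m)).
  apply: ler_sum => i _; rewrite (le_trans (term_le _ _ aMK xh yh))//.
  by rewrite subnKC// -ltnS.
rewrite sumr_const card_ord -[leLHS]mulr_natl.
rewrite [in leRHS]exprMn.
rewrite [leRHS]mulrCA ler_wpM2r ?natr_succ_le_exp2//.
by rewrite mulr_ge0// exprn_ge0// mulr_ge0// ltW.
Qed.

Lemma homog_sum_tail_le a M K m n (x y h : R) : coef_bound a M K ->
  K * h <= 4^-1 -> `|x| <= h -> `|y| <= h ->
  `|\sum_(m <= k < n) homog a k x y| <= 2 * M * (2 * (K * h)) ^+ m.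
Proof.
move=> aMK Kh xh yh; have [M0 K0 _] := aMK.
have h0 : 0 <= h by exact: le_trans xh.
have Kh0 : 0 <= K * h by rewrite mulr_ge0// ltW.
apply: (le_trans (ler_norm_sum _ _ _)).
apply: (@le_trans _ _ (\sum_(m <= k < n) M * (2 * (K * h)) ^+ k)).
  by apply: ler_sum => k _; exact: homog_le.
rewrite -mulr_sumr [leRHS]mulrAC [leRHS]mulrC ler_wpM2l// geometric_tail_le//; lra.
Qed.

(** Besides convergence, this yields the value at the center (n = 1),
    differentiability (n = 2), and the error bounds along lines (all n). *)
Lemma expands_tail f p a M K n (x y h : R) : expands f p a M K ->
  K * h <= 8^-1 -> `|x| <= h -> `|y| <= h ->
  `|f (p.1 + x, p.2 + y) - \sum_(m < n) homog a m x y|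
    <= 2 * M * (2 * (K * h)) ^+ n.
Proof.
move=> [aMK fE] Kh xh yh; have [M0 K0 _] := aMK.
have le8 (z : R) : `|z| <= h -> K * `|z| <= 8^-1.
  by move=> zh; rewrite (le_trans _ Kh)// ler_wpM2l// ltW.
refine (lim_norm_le (n := n) (fE x y (le8 _ xh) (le8 _ yh)) _) => N nN.
rewrite -!(big_mkord xpredT (fun m => homog a m x y)).
rewrite (@big_cat_nat _ _ _ n 0 N)//= addrAC subrr add0r.
by apply: homog_sum_tail_le => //; apply: (le_trans Kh); lra.
Qed.

Lemma expands_center f p a M K : expands f p a M K -> f p = a 0 0.
Proof.
move=> fE; have [[M0 K0 _] _] := fE.
have := expands_tail (x := 0) (y := 0) (h := 0) 1 fE.
rewrite mulr0 normr0 !addr0 mulr0 expr1 mulr0.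
rewrite big_ord1 /homog big_ord1 !expr0 !mulr1 -surjective_pairing.
by move=> /(_ ltac:(lra) (lexx _) (lexx _)); rewrite normr_le0 subr_eq0 => /eqP.
Qed.

(** Square partial sums exceed the triangular ones by terms of degree at
    least n only. *)
Lemma square_sum_split a n x y :
  \sum_(i < n) \sum_(j < n) a i j * x ^+ i * y ^+ j =
  \sum_(m < n) homog a m x y +
  \sum_(i < n) \sum_(n - i <= j < n) a i j * x ^+ i * y ^+ j.
Proof.
have -> : \sum_(m < n) homog a m x y =
    \sum_(i < n) \sum_(j < n - i) a i j * x ^+ i * y ^+ j.
  elim: n => [|n IH]; first by rewrite !big_ord0.
  rewrite big_ord_recr/= IH big_ord_recr/= /homog big_ord_recr/=.
  rewrite subnn subSnn big_ord1 addrA -big_split/=; congr (_ + _).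
  apply: eq_bigr => i _; rewrite subSn; last exact: ltnW.
  by rewrite big_ord_recr.
rewrite -big_split/=; apply: eq_bigr => i _.
by rewrite -!(big_mkord xpredT (fun j => a i j * x ^+ i * y ^+ j))
  (big_cat_nat (n := n - i))//= leq_subr.
Qed.

Lemma square_sum_rest_le a M K n (x y h : R) : coef_bound a M K ->
  K * h <= 1 -> `|x| <= h -> `|y| <= h ->
  `|\sum_(i < n) \sum_(n - i <= j < n) a i j * x ^+ i * y ^+ j|
    <= M * (4 * (K * h)) ^+ n.
Proof.
move=> aMK Kh xh yh; have [M0 K0 _] := aMK.
have h0 : 0 <= h by exact: le_trans xh.
have Kh0 : 0 <= K * h by rewrite mulr_ge0// ltW.
apply: (@le_trans _ _ (\sum_(i < n) \sum_(0 <= j < n) M * (K * h) ^+ n)).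
  apply: (le_trans (ler_norm_sum _ _ _)); apply: ler_sum => i _.
  rewrite [leRHS](big_cat_nat (n := n - i))//= ?leq_subr//.
  rewrite -[leLHS]add0r lerD//.
    by rewrite sumr_ge0// => j _; rewrite mulr_ge0// exprn_ge0.
  apply: (le_trans (ler_norm_sum _ _ _)); rewrite !big_nat.
  apply: ler_sum => j /andP[nij jn].
  apply: (le_trans (term_le _ _ aMK xh yh)); rewrite ler_wpM2l//.
  have nij' : (n <= i + j)%N by rewrite -leq_subLR.
  by rewrite ler_wiXn2l.
rewrite big_mkord !sumr_const card_ord -mulrnA -[leLHS]mulr_natl.
rewrite mulrCA ler_wpM2l// natrM.
have -> : 4 * (K * h) = 2 * (2 * (K * h)) by ring.
rewrite 2![in leRHS]exprMn mulrA ler_wpM2r ?exprn_ge0//.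
by rewrite ler_pM// natr_le_exp2.
Qed.

(** Each term of the absolutely convergent series at (r / 2, r / 2) is bounded
    by its sum, which is a Cauchy estimate with K = 2 / r. *)
Lemma real_analytic_expands (D : set (splitC R)) f p : real_analytic D f -> D p ->
  exists a M K, expands f p a M K.
Proof.
move=> fD Dp; have [a [r [r0 faE]]] := fD _ Dp.
have r2 : `|r / 2| < r by rewrite ger0_norm; lra.
have [abscvg _] := faE (r / 2) (r / 2) r2 r2.
set S := (fun n : nat => _) in abscvg.
have Sndecr : nondecreasing_seq S.
  apply/nondecreasing_seqP => n; rewrite /S big_ord_recr/=.
  rewrite -[leLHS]addr0 lerD//; last by apply: sumr_ge0 => j _.
  by apply: ler_sum => i _; rewrite big_ord_recr/= lerDl.
have Sle n : S n <= limn S by exact: nondecreasing_cvgn_le.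
have aMK : coef_bound a (limn S) (2 / r).
  split; [|by rewrite divr_gt0|] => [|i j].
    by apply: le_trans (Sle 0%N); rewrite /S big_ord0.
  set n := (maxn i j).+1.
  have iN : (i < n)%N by rewrite ltnS leq_maxl.
  have jN : (j < n)%N by rewrite ltnS leq_maxr.
  rewrite -ler_pdivrMr ?exprn_gt0 ?divr_gt0//.
  rewrite -exprVn invf_div exprD mulrA.
  apply: le_trans (Sle n).
  rewrite /S (bigD1 (Ordinal iN))//= (bigD1 (Ordinal jN))//=.
  rewrite !normrM !normrX (ger0_norm (x := r / 2)); last lra.
  rewrite -addrA lerDl addr_ge0// sumr_ge0// => i' _.
  by rewrite sumr_ge0.
exists a, (limn S), (2 / r); split => // x y Kx Ky.
have lt_r (z : R) : 2 / r * `|z| <= 8^-1 -> `|z| < r.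
  rewrite mulrAC ler_pdivrMr// => ?; lra.
have [_ sq] := faE x y (lt_r _ Kx) (lt_r _ Ky).
set h := Num.max `|x| `|y|.
have Kh : 2 / r * h <= 8^-1 by rewrite /h; case: (leP `|x| `|y|).
have xh : `|x| <= h by rewrite le_max lexx.
have yh : `|y| <= h by rewrite le_max lexx orbT.
set rest := fun n => \sum_(i < n) \sum_(n - i <= j < n) a i j * x ^+ i * y ^+ j.
have rest0 : rest @ \oo --> 0.
  apply/norm_cvg0P.
  apply: (@squeeze_cvgr _ _ _ _ (cst 0) (geometric (limn S) (4 * (2 / r * h)))).
  - apply: nearW => n; rewrite normr_ge0/=.
    by apply: (square_sum_rest_le n aMK _ xh yh); lra.
  - exact: cvg_cst.
  - apply: cvg_geometric; have : 0 <= 2 / r * h.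
      by rewrite mulr_ge0 ?divr_ge0 ?(le_trans _ xh)// ltW.
    by move=> ?; rewrite ger0_norm; lra.
have := cvgB (F := \oo) sq rest0; rewrite subr0 => sqr.
apply: cvg_trans (sqr _); apply: near_eq_cvg.
by apply: nearW => n; rewrite !fctE/= square_sum_split addrK.
Qed.

End PowerSeries.

(** * Termwise differentiation *)

Section Derivatives.
Variable R : realType.
Implicit Types (a : nat -> nat -> R) (f : splitC R -> R) (p : splitC R).

Lemma scale_split1 (e : R) : e *: (1 : splitC R) = (e, 0) :> splitC R.
Proof. by congr pair; [exact: mulr1|exact: mulr0]. Qed.

Lemma scale_splitk (e : R) : e *: (splitk : splitC R) = (0, e) :> splitC R.
Proof. by congr pair; [exact: mulr0|exact: mulr1]. Qed.

(** Quadratic error bounds, unlike little-o ones, survive the passage to the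
    limit of partial sums. *)
Lemma quadratic_is_derive f p (v : splitC R) (g B delta : R) : 0 < delta ->
  (forall e, `|e| < delta -> `|f (e *: v + p) - f p - e * g| <= B * e ^+ 2) ->
  is_derive p v f g.
Proof.
move=> d0 fB.
suff cv : (fun h : R => h^-1 *: ((f \o shift p) (h *: v) - f p)) @ 0^' --> g.
  by apply: DeriveDef; [exact: cvgP cv|exact: cvg_lim cv].
apply/cvgrPdist_le => e e0.
have B0 : 0 < `|B| + 1 by rewrite ltr_wpDl.
near=> h.
have h0 : h != 0 by near: h; exact: nbhs_dnbhs_neq.
have hd : `|h| < delta by near: h; apply: dnbhs0_lt.
have hB : `|h| * `|B| <= e.
  apply: (@le_trans _ _ (`|h| * (`|B| + 1))); first by rewrite ler_wpM2l// lerDl.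
  by rewrite -ler_pdivlMr//; near: h; apply: dnbhs0_le; exact: divr_gt0.
have -> : g - h^-1 *: ((f \o shift p) (h *: v) - f p) =
    - (h^-1 * (f (h *: v + p) - f p - h * g)).
  by rewrite /= !mulrBr mulKf// opprB -mulrBr.
rewrite normrN normrM normfV ler_pdivrMl ?normr_gt0//.
apply: (le_trans (fB _ hd)); rewrite (le_trans (ler_norm _))//.
rewrite normrM normrX expr2 mulrCA ler_wpM2l//.
by rewrite mulrC.
Unshelve. all: by end_near. Qed.

Definition coef_ds a i j : R := i.+1%:R * a i.+1 j.
Definition coef_tr a i j : R := a j i.

Lemma coef_bound_ds a M K : coef_bound a M K ->
  coef_bound (coef_ds a) (M * K) (2 * K).
Proof.
move=> [M0 K0 aMK]; split; [by rewrite mulr_ge0// ltW|by rewrite mulr_gt0|].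
move=> i j; rewrite /coef_ds normrM ger0_norm//.
apply: (@le_trans _ _ (2 ^+ (i + j) * (M * K ^+ (i.+1 + j)))).
  rewrite ler_pM//; apply: (le_trans (natr_succ_le_exp2 R _)).
  by rewrite ler_weXn2l ?leq_addr// ler1n.
by rewrite exprMn addSn exprS le_eqVlt; apply/orP; left; apply/eqP; ring.
Qed.

(** The constant has to be geometric in i, in order to be summable against
    the coefficients of a power series. *)
Lemma pow_remainder_le (x e rho : R) i : `|x| <= rho -> `|x + e| <= rho ->
  0 < rho ->
  `|(x + e) ^+ i - x ^+ i - e * (i%:R * x ^+ i.-1)|
    <= e ^+ 2 / rho ^+ 2 * (2 * rho) ^+ i.
Proof.
move=> xr xer r0; elim: i => [|i IH].
  by rewrite !expr0 mul0r mulr0 !subrr normr0 mulr1 divr_ge0 ?sqr_ge0// exprn_ge0 ?ltW.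
(* The remainder r_i satisfies r_(i+1) = (x + e) r_i + i e^2 x^(i-1). *)
have -> : (x + e) ^+ i.+1 - x ^+ i.+1 - e * (i.+1%:R * x ^+ i.+1.-1) =
    (x + e) * ((x + e) ^+ i - x ^+ i - e * (i%:R * x ^+ i.-1)) +
    e ^+ 2 * (i%:R * x ^+ i.-1).
  case: i {IH} => [|i] /=; first by rewrite !expr0 !expr1; ring.
  by rewrite -(natr1 i.+1) !exprS; ring.
apply: (le_trans (ler_normD _ _)).
have -> : e ^+ 2 / rho ^+ 2 * (2 * rho) ^+ i.+1 =
    rho * (e ^+ 2 / rho ^+ 2 * (2 * rho) ^+ i) +
    e ^+ 2 * (2 ^+ i * (rho ^+ i.+1 / rho ^+ 2)).
  rewrite !exprMn !exprS; field; exact: lt0r_neq0.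
rewrite lerD//; first by rewrite normrM ler_pM.
rewrite normrM (ger0_norm (sqr_ge0 e)) ler_wpM2l ?sqr_ge0//.
rewrite normrM normrX ger0_norm//.
case: i {IH} => [|i] /=.
  by rewrite mul0r mulr_ge0 ?exprn_ge0 ?divr_ge0 ?exprn_ge0// ltW.
rewrite ler_pM// ?exprn_ge0// ?natr_le_exp2//.
have -> : rho ^+ i.+2 / rho ^+ 2 = rho ^+ i.
  by rewrite !exprS; field; exact: lt0r_neq0.
by rewrite lerXn2r ?nnegrE// ltW.
Qed.

Lemma homog_ds_remainder a (x y e : R) m :
  homog a m.+1 (x + e) y - homog a m.+1 x y - e * homog (coef_ds a) m x y =
  \sum_(i < m.+2) a i (m.+1 - i)%N * y ^+ (m.+1 - i) *
    ((x + e) ^+ i - x ^+ i - e * (i%:R * x ^+ i.-1)).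
Proof.
have -> : homog (coef_ds a) m x y =
    \sum_(i < m.+2) a i (m.+1 - i)%N * y ^+ (m.+1 - i) * (i%:R * x ^+ i.-1).
  rewrite big_ord_recl/= mul0r mulr0 add0r; apply: eq_bigr => i _.
  rewrite /coef_ds /bump/= add1n subSS; ring.
rewrite /homog mulr_sumr -!sumrB; apply: eq_bigr => i _; ring.
Qed.

(** The bound does not depend on n: this uniformity is what makes termwise
    differentiation possible. *)
Lemma sum_homog_ds_remainder a M K n (x y e rho : R) : coef_bound a M K ->
  0 < rho -> K * rho <= 8^-1 ->
  `|x| <= rho -> `|x + e| <= rho -> `|y| <= rho ->
  `|\sum_(m < n.+1) homog a m (x + e) y - \sum_(m < n.+1) homog a m x y
    - e * \sum_(m < n) homog (coef_ds a) m x y|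
  <= 2 * M / rho ^+ 2 * e ^+ 2.
Proof.
move=> aMK r0 Kr xr xer yr; have [M0 K0 aB] := aMK.
(* The term of degree 0 is constant and cancels. *)
rewrite !(big_ord_recl n)/=.
have h0 z : homog a 0 z y = a 0 0 by rewrite /homog big_ord1 !mulr1.
rewrite !h0 [X in X - _ - _]addrC addrKA.
rewrite mulr_sumr -!sumrB.
have Kr0 : 0 <= K * rho by rewrite mulr_ge0// ltW.
have term m : `|homog a (bump 0 m) (x + e) y - homog a (bump 0 m) x y
    - e * homog (coef_ds a) m x y|
    <= M * (e ^+ 2 / rho ^+ 2) * (4 * (K * rho)) ^+ m.+1.
  rewrite /bump/= add1n homog_ds_remainder.
  apply: (le_trans (ler_norm_sum _ _ _)).
  apply: (@le_trans _ _ (\sum_(i < m.+2)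
      M * (e ^+ 2 / rho ^+ 2) * (2 * (K * rho)) ^+ m.+1)); last first.
    rewrite sumr_const card_ord -[leLHS]mulr_natl mulrCA ler_wpM2l//.
      by rewrite mulr_ge0// divr_ge0 ?sqr_ge0// exprn_ge0// ltW.
    have -> : 4 = 2 * 2 :> R by lra.
    rewrite -[in leRHS]mulrA [in leRHS]exprMn ler_wpM2r ?exprn_ge0//; first lra.
    exact: natr_succ_le_exp2.
  apply: ler_sum => i _; have im : (i <= m.+1)%N by rewrite -ltnS.
  rewrite normrM.
  apply: (@le_trans _ _ ((M * K ^+ m.+1 * rho ^+ (m.+1 - i)) *
     (e ^+ 2 / rho ^+ 2 * (2 * rho) ^+ i))).
    rewrite ler_pM//; last exact: pow_remainder_le.
    rewrite normrM normrX ler_pM ?exprn_ge0//.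
      by have := aB i (m.+1 - i)%N; rewrite subnKC.
    by rewrite lerXn2r// nnegrE ltW.
  have -> : M * (e ^+ 2 / rho ^+ 2) * (2 * (K * rho)) ^+ m.+1 =
     M * K ^+ m.+1 * (e ^+ 2 / rho ^+ 2) * (2 ^+ m.+1 * rho ^+ m.+1).
    by rewrite !exprMn; ring.
  have -> : M * K ^+ m.+1 * rho ^+ (m.+1 - i) *
      (e ^+ 2 / rho ^+ 2 * (2 * rho) ^+ i) =
     M * K ^+ m.+1 * (e ^+ 2 / rho ^+ 2) *
       (2 ^+ i * (rho ^+ (m.+1 - i) * rho ^+ i)) by rewrite exprMn; ring.
  rewrite -exprD subnK// ler_wpM2l//.
    have Km : 0 <= K ^+ m.+1 by rewrite exprn_ge0 ?ltW.
    by apply: mulr_ge0; [exact: mulr_ge0|rewrite divr_ge0 ?sqr_ge0].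
  apply: ler_wpM2r; first by rewrite exprn_ge0// ltW.
  by rewrite ler_weXn2l// ler1n.
apply: (le_trans (ler_norm_sum _ _ _)).
apply: (@le_trans _ _ (\sum_(i < n)
   M * (e ^+ 2 / rho ^+ 2) * (4 * (K * rho)) ^+ i.+1)); first exact: ler_sum.
rewrite -mulr_sumr.
have -> : 2 * M / rho ^+ 2 * e ^+ 2 = M * (e ^+ 2 / rho ^+ 2) * 2 by ring.
rewrite ler_wpM2l//; first by rewrite mulr_ge0// divr_ge0// ?sqr_ge0 ?exprn_ge0// ltW.
have -> : \sum_(i < n) (4 * (K * rho)) ^+ i.+1 =
    \sum_(1 <= k < n.+1) (4 * (K * rho)) ^+ k.
  by rewrite big_add1/= big_mkord.
apply: (le_trans (geometric_tail_le _ _ _ _)); lra.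
Qed.

Lemma sum_homog_cvg a M K (x y : R) : coef_bound a M K ->
  K * `|x| <= 4^-1 -> K * `|y| <= 4^-1 ->
  cvgn (fun n => \sum_(m < n) homog a m x y).
Proof.
move=> aMK Kx Ky; have [M0 K0 _] := aMK.
set h := Num.max `|x| `|y|.
have Kh : K * h <= 4^-1 by rewrite /h; case: (leP `|x| `|y|).
have xh : `|x| <= h by rewrite le_max lexx.
have yh : `|y| <= h by rewrite le_max lexx orbT.
have h0 : 0 <= K * h by rewrite mulr_ge0// ?(le_trans _ xh)// ltW.
have -> : (fun n => \sum_(m < n) homog a m x y) =
    series (fun m => homog a m x y).
  by apply/funext => n; rewrite seriesEord.
apply: normed_cvg.
apply: (@series_le_cvg _ _ (geometric M (2 * (K * h)))).
- by move=> n; exact: normr_ge0.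
- by move=> n; rewrite /= mulr_ge0// exprn_ge0//; lra.
- by move=> n /=; exact: homog_le.
- by apply: is_cvg_geometric_series; rewrite ger0_norm; lra.
Qed.

(** Since i + 1 <= 2 ^ i, the derived coefficients satisfy a geometric bound
    with 2 K in place of K, hence the smaller square. *)
Lemma expands_ds f p a M K : expands f p a M K ->
  (forall x y, 2 * K * `|x| <= 8^-1 -> 2 * K * `|y| <= 8^-1 ->
     derivable f (p.1 + x, p.2 + y) (1 : splitC R)) /\
  expands (d_s f) p (coef_ds a) (M * K) (2 * K).
Proof.
move=> [aMK fE]; have [M0 K0 aB] := aMK.
pose G x y := limn (fun n => \sum_(m < n) homog (coef_ds a) m x y).
have Gcv x y : 2 * K * `|x| <= 8^-1 -> 2 * K * `|y| <= 8^-1 ->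
   (fun n => \sum_(m < n) homog (coef_ds a) m x y) @ \oo --> G x y.
  move=> Kx Ky; apply: (sum_homog_cvg (coef_bound_ds aMK)); lra.
have fG x y : 2 * K * `|x| <= 8^-1 -> 2 * K * `|y| <= 8^-1 ->
   is_derive ((p.1 + x, p.2 + y) : splitC R) (1 : splitC R) f (G x y).
  move=> Kx Ky; pose rho := 8^-1 / K.
  have r0 : 0 < rho by rewrite divr_gt0.
  have Kr : K * rho = 8^-1 by rewrite mulrC divfK// gt_eqF.
  have hr (z : R) : K * `|z| <= 8^-1 -> `|z| <= rho by rewrite ler_pdivlMr// mulrC.
  apply: (@quadratic_is_derive _ _ _ _ (2 * M / rho ^+ 2) (2^-1 * rho)) => [|e er].
    by rewrite mulr_gt0.
  have er' : K * `|e| < 2^-1 * 8^-1.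
    by rewrite -Kr mulrCA ltr_pM2l.
  have xr : K * `|x| <= 8^-1 by lra.
  have yr : K * `|y| <= 8^-1 by lra.
  have xer : K * `|x + e| <= 8^-1.
    by rewrite (le_trans (ler_wpM2l (ltW K0) (ler_normD _ _)))//; lra.
  have -> : e *: (1 : splitC R) + (p.1 + x, p.2 + y) =
      (p.1 + (x + e), p.2 + y) :> splitC R.
    by rewrite scale_split1; congr pair; [rewrite /= addrCA (addrC e)|exact: add0r].
  have cv1 := fE _ _ xer yr; have cv2 := fE _ _ xr yr.
  have cv3 := Gcv _ _ Kx Ky.
  have cv12 := cvgB (F := \oo) cv1 cv2.
  have cv12S : (fun n => \sum_(m < n.+1) homog a m (x + e) y
       - \sum_(m < n.+1) homog a m x y) @ \oo -->
       f (p.1 + (x + e), p.2 + y) - f (p.1 + x, p.2 + y).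
    by have := cv12 _; rewrite -cvg_shiftS; apply.
  have cv3e : (fun n => e * \sum_(m < n) homog (coef_ds a) m x y) @ \oo --> e * G x y.
    by apply: cvgM => //; exact: cvg_cst.
  have cv := cvgB (F := \oo) cv12S cv3e.
  rewrite -[X in `|X|]subr0.
  apply: (@lim_norm_le _ _ _ _ _ 0 (cv _)) => N _; rewrite subr0.
  apply: (sum_homog_ds_remainder _ aMK) => //; by [rewrite Kr|exact: hr].
split=> [x y Kx Ky|]; first exact: (@ex_derive _ _ _ _ _ _ _ (fG x y Kx Ky)).
split; first exact: coef_bound_ds.
move=> x y Kx Ky; rewrite /d_s.
by have -> := (@derive_val _ _ _ _ _ _ _ (fG x y Kx Ky)); exact: Gcv.
Qed.

End Derivatives.

(** * Differentiability and the second variable *)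

Section Transposition.
Variable R : realType.
Implicit Types (a : nat -> nat -> R) (f : splitC R -> R) (p : splitC R).

Definition split_swap p : splitC R := (p.2, p.1).

Lemma homog_tr a m (x y : R) : homog (coef_tr a) m y x = homog a m x y.
Proof.
rewrite /homog (reindex_inj rev_ord_inj)/=; apply: eq_bigr => i _.
have im : (i <= m)%N by rewrite -ltnS.
by rewrite subSS subKn// /coef_tr mulrAC.
Qed.

Lemma expands_swap f p a M K : expands f p a M K ->
  expands (f \o split_swap) (split_swap p) (coef_tr a) M K.
Proof.
move=> [[M0 K0 aMK] fE]; split; first by split=> // i j; rewrite addnC; exact: aMK.
move=> x y Kx Ky /=; have := fE y x Ky Kx.
by under eq_fun do under eq_bigr do rewrite -homog_tr.
Qed.

Lemma derive_swap f p :
  ((fun h : R => h^-1 *: ((f \o split_swap \o shift p) (h *: (1 : splitC R))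
      - (f \o split_swap) p)) =
   fun h : R => h^-1 *: ((f \o shift (split_swap p)) (h *: (splitk : splitC R))
      - f (split_swap p))).
Proof.
by apply/funext => h /=; rewrite scale_split1 scale_splitk.
Qed.

Lemma d_s_swap f p : d_s (f \o split_swap) p = d_t f (split_swap p).
Proof. by rewrite /d_s /d_t /derive derive_swap. Qed.

Lemma derivable_swap f p :
  derivable (f \o split_swap) p (1 : splitC R) =
  derivable f (split_swap p) splitk.
Proof. by rewrite /derivable derive_swap. Qed.

Definition coef_dt a i j : R := j.+1%:R * a i j.+1.

Lemma split_swapK : involutive split_swap.
Proof. by case. Qed.

(** Exchanging the variables reduces this to the case of s. *)
Lemma expands_dt f p a M K : expands f p a M K ->
  (forall x y, 2 * K * `|x| <= 8^-1 -> 2 * K * `|y| <= 8^-1 ->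
     derivable f (p.1 + x, p.2 + y) splitk) /\
  expands (d_t f) p (coef_dt a) (M * K) (2 * K).
Proof.
move=> /expands_swap/expands_ds[der exp]; split=> [x y Kx Ky|].
  by have := der y x Ky Kx; rewrite derivable_swap.
have -> : d_t f = d_s (f \o split_swap) \o split_swap.
  by apply/funext => q /=; rewrite d_s_swap split_swapK.
by have := expands_swap exp; rewrite split_swapK.
Qed.

End Transposition.

Section Differentiable.
Variable R : realType.
Implicit Types (f : splitC R -> R) (p : splitC R).

(** Valued in the regular module R^o, as a differential is a linear map between
    modules. *)
Definition lin_form (al be : R) (z : splitC R) : R^o := al * z.1 + be * z.2.

Lemma lin_form_is_linear al be : linear (lin_form al be).
Proof.
move=> k u v; rewrite /lin_form /GRing.scale/= /GRing.scale/=; ring.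
Qed.

HB.instance Definition _ al be :=
  GRing.isLinear.Build R (splitC R) R^o _ (lin_form al be)
    (lin_form_is_linear al be).

Lemma lin_form_continuous al be : continuous (lin_form al be).
Proof.
move=> z; apply: cvgD; apply: cvgM; try exact: cvg_cst; [exact: cvg_fst|exact: cvg_snd].
Qed.

Lemma splitC_norm (z : splitC R) : `|z| = Num.max `|z.1| `|z.2|.
Proof. by []. Qed.

Lemma quadratic_differentiable f p (al be B delta : R) : 0 < delta ->
  (forall z : splitC R, `|z| < delta ->
     `|f (z + p) - f p - lin_form al be z| <= B * `|z| ^+ 2) ->
  differentiable f p.
Proof.
move=> d0 fB.
suff E : f \o shift p = cst (f p) + lin_form al be +o_ 0 id.
  have dE := diff_unique (@lin_form_continuous al be) E.
  by apply/diff_locallyP; rewrite dE; split; first exact: lin_form_continuous.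
apply/eqaddoP => e e0.
have B0 : 0 < `|B| + 1 by rewrite ltr_wpDl.
have zd0 := @nbhs0_lt R (splitC R) _ d0.
have zB0 := @nbhs0_le R (splitC R) _ (divr_gt0 e0 B0).
near=> z.
have zd : `|z| < delta by near: z; exact: zd0.
have zB : `|z| * (`|B| + 1) <= e by rewrite -ler_pdivlMr//; near: z; exact: zB0.
rewrite /= !fctE/= opprD addrA; apply: (le_trans (fB _ zd)).
apply: (@le_trans _ _ ((`|B| + 1) * `|z| ^+ 2)).
  rewrite ler_wpM2r ?exprn_ge0//; have := ler_norm B; lra.
by rewrite expr2 mulrA ler_wpM2r// mulrC.
Unshelve. all: by end_near. Qed.

Lemma expands_differentiable f p a M K : expands f p a M K ->
  differentiable f p.
Proof.
move=> fE; have [[M0 K0 _] _] := fE.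
apply: (@quadratic_differentiable _ _ (a 1%N 0%N) (a 0%N 1%N)
  (2 * M * (2 * K) ^+ 2) (8^-1 / K)); first by rewrite divr_gt0.
move=> z zK.
have Kz : K * `|z| <= 8^-1 by rewrite mulrC -ler_pdivlMr// ltW.
have zx : `|z.1| <= `|z| by rewrite splitC_norm le_max lexx.
have zy : `|z.2| <= `|z| by rewrite splitC_norm le_max lexx orbT.
have := expands_tail 2 fE Kz zx zy.
rewrite (expands_center fE) 2!big_ord_recr big_ord0/= add0r.
rewrite /homog big_ord1 2!big_ord_recr big_ord0/= !expr0 !expr1 !mulr1.
have -> : z + p = (p.1 + z.1, p.2 + z.2) by rewrite addrC.
rewrite /lin_form opprD addrA add0r [_ * z.2 + _]addrC.
by rewrite [2 * (K * _)]mulrA [in leRHS]exprMn mulrA.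
Qed.

Lemma derive_split f p (v : splitC R) : differentiable f p ->
  'D_v f p = v.1 * d_s f p + v.2 * d_t f p.
Proof.
move=> df; rewrite /d_s /d_t !deriveE//.
have {1}-> : v = v.1 *: (1 : splitC R) + v.2 *: splitk.
  rewrite scale_split1 scale_splitk; case: v => x y.
  by congr pair; rewrite /= ?addr0 ?add0r.
by rewrite linearD !linearZ.
Qed.

Lemma is_derive_curve f (c : R -> splitC R) (u : R) (dc : splitC R) :
  differentiable f (c u) -> is_derive u 1 c dc ->
  is_derive u 1 (f \o c) (dc.1 * d_s f (c u) + dc.2 * d_t f (c u)).
Proof.
move=> df [c1 cE].
have dcu : differentiable c u by apply/derivable1_diffP.
have dfc : differentiable (f \o c) u by exact: differentiable_comp.
apply: DeriveDef; first exact: diff_derivable.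
by rewrite deriveE// diff_comp//= -derive_split// -cE !deriveE.
Qed.

End Differentiable.

(** * Analytic functions of one variable *)

Section OneVariable.
Variable R : realType.
Implicit Types (g : R -> R) (c : nat -> R).

(** Analyticity at 0 without limits or series: the Taylor polynomial with n
    terms is accurate to order n, with constants geometric in n.  In this form
    products involve finite sums only. *)
Definition taylor0 g c (C K r : R) : Prop :=
  [/\ 0 <= C, 0 < K, 0 < r & forall n h, `|h| < r ->
    `|g h - \sum_(m < n) c m * h ^+ m| <= C * (K * `|h|) ^+ n].

Definition analytic0 g : Prop := exists c C K r, taylor0 g c C K r.

Lemma taylor0_weaken g c C K r C' K' r' : taylor0 g c C K r ->
  C <= C' -> K <= K' -> 0 < r' -> r' <= r -> taylor0 g c C' K' r'.
Proof.
move=> [C0 K0 r0 gc] CC KK r'0 rr; split => //; [exact: le_trans CC|exact: lt_le_trans KK|].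
move=> n h hr; apply: (le_trans (gc n h (lt_le_trans hr rr))).
have Kh : 0 <= K * `|h| by rewrite mulr_ge0// ltW.
by rewrite ler_pM ?exprn_ge0// lerXn2r ?nnegrE ?mulr_ge0 ?ler_wpM2r// ltW// (lt_le_trans K0).
Qed.

Lemma taylor0_common g1 g2 c1 c2 C1 K1 r1 C2 K2 r2 :
  taylor0 g1 c1 C1 K1 r1 -> taylor0 g2 c2 C2 K2 r2 ->
  exists C K r, K * r <= 1 /\ taylor0 g1 c1 C K r /\ taylor0 g2 c2 C K r.
Proof.
move=> t1 t2; have [C10 K10 r10 _] := t1; have [C20 K20 r20 _] := t2.
exists (C1 + C2), (K1 + K2), (Num.min (Num.min r1 r2) (K1 + K2)^-1).
have K0 : 0 < K1 + K2 by rewrite addr_gt0.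
split; first by rewrite mulrC -ler_pdivlMr// mul1r ge_min lexx orbT.
split; [apply: (taylor0_weaken t1)|apply: (taylor0_weaken t2)];
  rewrite ?lt_min ?invr_gt0 ?r10 ?r20 ?K0// ?ge_min ?lexx ?orbT//; lra.
Qed.

(** A coefficient is the difference of two consecutive approximations, both of
    which are close to g. *)
Lemma taylor0_coef g c C K r m : taylor0 g c C K r -> `|c m| <= 2 * C * K ^+ m.
Proof.
move=> [C0 K0 r0 gc].
(* Inside the radius, and such that K h <= 1. *)
pose h := Num.min (r / 2) K^-1.
have h0 : 0 < h by rewrite lt_min invr_gt0 K0 divr_gt0.
have hr : `|h| < r by rewrite gtr0_norm// gt_min; apply/orP; left; lra.
have Kh : K * `|h| <= 1.
  by rewrite gtr0_norm// mulrC -ler_pdivlMr// mul1r ge_min lexx orbT.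
have Kh0 : 0 <= K * `|h| by rewrite mulr_ge0// ltW.
have g1 := gc m h hr; have := gc m.+1 h hr; rewrite big_ord_recr/= => g2.
have hm : `|c m * h ^+ m| <= 2 * C * (K * `|h|) ^+ m.
  have -> : c m * h ^+ m = (g h - \sum_(i < m) c i * h ^+ i)
     - (g h - (\sum_(i < m) c i * h ^+ i + c m * h ^+ m)) by ring.
  apply: (le_trans (ler_normB _ _)).
  have -> : 2 * C * (K * `|h|) ^+ m = C * (K * `|h|) ^+ m + C * (K * `|h|) ^+ m.
    by ring.
  rewrite lerD//; apply: (le_trans g2); rewrite ler_wpM2l//.
  by rewrite exprS ler_piMl// exprn_ge0.
move: hm; rewrite normrM normrX exprMn mulrA ler_pM2r// exprn_gt0//.
by rewrite normr_gt0 gt_eqF.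
Qed.

Lemma analytic0_cst (k : R) : analytic0 (fun=> k).
Proof.
exists (fun m => if m is 0%N then k else 0), `|k|, 1, 1; split => // n h _.
case: n => [|n]; first by rewrite big_ord0 subr0 expr0 mulr1.
rewrite big_ord_recl/= expr0 mulr1 big1 ?addr0 => [|i _]; last by rewrite mul0r.
by rewrite subrr normr0 mulr_ge0// exprn_ge0// mul1r.
Qed.

Lemma analytic0D g1 g2 : analytic0 g1 -> analytic0 g2 ->
  analytic0 (fun h => g1 h + g2 h).
Proof.
move=> [c1 [? [? [? t1]]]] [c2 [? [? [? t2]]]].
have [C [K [r [_ [[C0 K0 r0 g1c] [_ _ _ g2c]]]]]] := taylor0_common t1 t2.
exists (fun m => c1 m + c2 m), (2 * C), K, r; split=> //; first by rewrite mulr_ge0.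
move=> n h hr; under eq_bigr do rewrite mulrDl.
rewrite big_split/= opprD addrACA (le_trans (ler_normD _ _))//.
have := g1c n h hr; have := g2c n h hr; lra.
Qed.

(** The product of two Taylor polynomials is a square partial sum with
    coefficients c1 i * c2 j; its part of degree at least n is the rest of
    that square, and is geometrically small. *)
Lemma analytic0M g1 g2 : analytic0 g1 -> analytic0 g2 ->
  analytic0 (fun h => g1 h * g2 h).
Proof.
move=> [c1 [? [? [? t1]]]] [c2 [? [? [? t2]]]].
have [C [K [r [Kr [t1' t2']]]]] := taylor0_common t1 t2.
have [[C0 K0 r0 g1c] [_ _ _ g2c]] := (t1', t2').
pose a i j := c1 i * c2 j.
have aMK : coef_bound a ((2 * C) * (2 * C)) K.
  have C20 : 0 <= 2 * C by rewrite mulr_ge0.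
  split => // [|i j]; first exact: mulr_ge0.
  rewrite normrM exprD [leRHS]mulrACA; apply: ler_pM => //.
    exact: taylor0_coef t1'.
  exact: taylor0_coef t2'.
(* 7 = 3 + 4: three from the two Taylor errors, four from the rest of the
   square sum. *)
exists (fun m => \sum_(i < m.+1) a i (m - i)%N), (7 * C ^+ 2), (4 * K), r.
split=> [|||n h hr] //; [by rewrite mulr_ge0// exprn_ge0|by rewrite mulr_gt0|].
have Kh0 : 0 <= K * `|h| by rewrite mulr_ge0// ltW.
have Kh : K * `|h| <= 1.
  by apply: le_trans Kr; rewrite ler_wpM2l// ltW.
have Khn : (K * `|h|) ^+ n <= 1 by rewrite exprn_ile1.
have Khn0 : 0 <= (K * `|h|) ^+ n by rewrite exprn_ge0.
set P1 := \sum_(m < n) c1 m * h ^+ m; set P2 := \sum_(m < n) c2 m * h ^+ m.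
set Q := \sum_(m < n) _; set q := (K * `|h|) ^+ n in Khn Khn0 *.
have PQ : `|P1 * P2 - Q| <= (2 * C) * (2 * C) * (4 * (K * `|h|)) ^+ n.
  have -> : P1 * P2 = \sum_(i < n) \sum_(j < n) a i j * h ^+ i * h ^+ j.
    rewrite big_distrlr/=; apply: eq_bigr => i _; apply: eq_bigr => j _.
    by rewrite mulrACA mulrA.
  rewrite square_sum_split.
  have -> : Q = \sum_(m < n) homog a m h h.
    apply: eq_bigr => m _; rewrite /homog mulr_suml; apply: eq_bigr => i _.
    by rewrite -mulrA -exprD subnKC// -ltnS.
  by rewrite addrAC subrr add0r; exact: square_sum_rest_le.
have e1 : `|g1 h - P1| <= C * q := g1c n h hr.
have e2 : `|g2 h - P2| <= C * q := g2c n h hr.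
have b1 : `|g1 h| <= C by have := g1c 0%N h hr; rewrite big_ord0 subr0 mulr1.
have b2 : `|g2 h| <= C by have := g2c 0%N h hr; rewrite big_ord0 subr0 mulr1.
have b3 : `|P1| <= 2 * C.
  have -> : P1 = g1 h - (g1 h - P1) by ring.
  rewrite (le_trans (ler_normB _ _))//.
  have : C * q <= C by rewrite ler_piMr.
  lra.
have -> : g1 h * g2 h - Q = (g1 h - P1) * g2 h + P1 * (g2 h - P2) + (P1 * P2 - Q).
  by ring.
have q4 : q <= (4 * (K * `|h|)) ^+ n.
  by rewrite lerXn2r ?nnegrE ?mulr_ge0//; lra.
rewrite -(mulrA 4).
apply: (le_trans (ler_normD _ _)).
have -> : 7 * C ^+ 2 * (4 * (K * `|h|)) ^+ n =
   3 * C ^+ 2 * (4 * (K * `|h|)) ^+ n + (2 * C) * (2 * C) * (4 * (K * `|h|)) ^+ n.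
  by ring.
rewrite lerD// (le_trans (ler_normD _ _))//.
apply: (@le_trans _ _ (3 * C ^+ 2 * q)); last first.
  by rewrite ler_wpM2l// mulr_ge0// exprn_ge0.
have -> : 3 * C ^+ 2 * q = C * q * C + 2 * C * (C * q) by ring.
by rewrite lerD// normrM ler_pM.
Qed.

Lemma eq0_of_small (x A : R) (d : R) : 0 < d ->
  (forall e, 0 < e -> e < d -> `|x| <= A * e) -> x = 0.
Proof.
move=> d0 xA; apply/eqP; rewrite -normr_le0; apply/ler_addgt0Pl => e e0.
rewrite addr0; have A0 : 0 < `|A| + 1 by rewrite ltr_wpDl.
pose e' := Num.min (d / 2) (e / (`|A| + 1)).
have e'0 : 0 < e' by rewrite lt_min !divr_gt0.
have e'd : e' < d by rewrite gt_min; apply/orP; left; lra.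
apply: (le_trans (xA _ e'0 e'd)).
apply: (@le_trans _ _ ((`|A| + 1) * e')).
  by rewrite ler_wpM2r ?ltW// (le_lt_trans (ler_norm _))// ltrDl.
by rewrite mulrC -ler_pdivlMr// ge_min lexx orbT.
Qed.

(** Vanishing on one side of 0 kills the coefficients one after the other; the
    error bounds of all orders then force g to vanish on both sides. *)
Lemma analytic0_eq0 g (d : R) : analytic0 g -> 0 < d ->
  (forall h, 0 < h -> h < d -> g (- h) = 0) ->
  exists2 r, 0 < r & forall h, `|h| < r -> g h = 0.
Proof.
move=> [c [C [K [r [C0 K0 r0 gc]]]]] d0 g0.
have c0 m : c m = 0.
  elim/ltn_ind: m => m IH.
  apply: (@eq0_of_small _ (C * K ^+ m.+1) (Num.min d r)).
    by rewrite lt_min d0.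
  move=> e e0; rewrite lt_min => /andP[ed er].
  have := gc m.+1 (- e); rewrite normrN (gtr0_norm e0) => /(_ er).
  rewrite g0// big_ord_recr/= big1 => [|i _]; last by rewrite IH// mul0r.
  rewrite !add0r normrN normrM normrX normrN (gtr0_norm e0).
  have -> : C * (K * e) ^+ m.+1 = C * K ^+ m.+1 * e * e ^+ m.
    by rewrite exprMn !exprS; ring.
  by rewrite ler_pM2r// exprn_gt0.
exists (Num.min r (2 * K)^-1); first by rewrite lt_min r0 invr_gt0 mulr_gt0.
move=> h; rewrite lt_min => /andP[hr hK].
have Kh : K * `|h| <= 2^-1.
  have : `|h| * (2 * K) < 1 by rewrite -ltr_pdivlMr ?mul1r// mulr_gt0.
  lra.
have gle n : `|g h| <= geometric C 2^-1 n.
  have := gc n h hr; rewrite big1 => [|i _]; last by rewrite c0 mul0r.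
  rewrite subr0 => /le_trans; apply; rewrite /= ler_wpM2l// lerXn2r ?nnegrE//.
  by rewrite mulr_ge0// ltW.
have gc0 : geometric C 2^-1 @ \oo --> (0 : R).
  by apply: cvg_geometric; rewrite ger0_norm; lra.
apply/eqP; rewrite -normr_le0 -(cvg_lim _ gc0)//.
by apply: limr_ge; [exact: cvgP gc0|exact: nearW].
Qed.

(** The supremum of the t such that phi vanishes on [0, t] can only be 1, since
    phi, being zero to the left of it, is zero to its right as well. *)
Lemma analytic_continuation_segment (phi : R -> R) (d : R) : 0 < d ->
  (forall t, 0 <= t -> t <= 1 -> analytic0 (fun h => phi (t + h))) ->
  (forall t, 0 <= t -> t < d -> phi t = 0) -> phi 1 = 0.
Proof.
move=> d0 an phi0.
pose T : set R := [set t | [/\ 0 <= t, t <= 1 & forall s, 0 <= s -> s <= t -> phi s = 0]].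
have T0 : T 0 by split => // s s0 s1; apply: phi0 => //; exact: le_lt_trans d0.
have Tsup : has_sup T by split; [exists 0|exists 1 => t []].
pose tau := sup T.
have tau0 : 0 <= tau by apply: ub_le_sup => //; case: Tsup.
have tau1 : tau <= 1 by apply: ge_sup; [exists 0|move=> t []].
have taupos : 0 < tau.
  pose e := Num.min (d / 2) 1.
  have e0 : 0 < e by rewrite lt_min divr_gt0//=.
  apply: (lt_le_trans e0); apply: ub_le_sup; first by case: Tsup.
  split; [exact: ltW|by rewrite ge_min lexx orbT|] => s s0 se.
  apply: phi0 => //; apply: (le_lt_trans se); rewrite gt_min; apply/orP; left; lra.
have below s : 0 <= s -> s < tau -> phi s = 0.
  move=> s0 st; have [t [t0 t1 tT] ts] := @sup_adherent _ T (tau - s) ltac:(lra) Tsup.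
  by apply: tT => //; rewrite -/tau in ts; lra.
have [|r r0 phir] := analytic0_eq0 (an _ tau0 tau1) taupos.
  by move=> h h0 ht; apply: below; lra.
have [tau_lt|tau_ge] := ltP tau 1; last first.
  have -> : 1 = tau + 0 by lra.
  by apply: phir; rewrite normr0.
pose e := Num.min (r / 2) (1 - tau).
have e0 : 0 < e by rewrite lt_min divr_gt0//= subr_gt0.
have er : e < r by rewrite gt_min; apply/orP; left; lra.
have e1 : e <= 1 - tau by rewrite ge_min lexx orbT.
have : T (tau + e).
  split; [lra|lra|] => s s0 se.
  have [st|st] := ltP s tau; first exact: below.
  have -> : s = tau + (s - tau) by lra.
  by apply: phir; rewrite ger0_norm; lra.
move=> /(ub_le_sup (proj2 Tsup)); rewrite -/tau; lra.
Qed.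

End OneVariable.

(** * Analyticity along lines and the identity theorem *)

Section Identity.
Variable R : realType.
Implicit Types (f g : splitC R -> R) (p q : splitC R) (D : set (splitC R)).

Definition expandable D f : Prop :=
  forall p, D p -> exists a M K, expands f p a M K.

(** Weaker than being given by a double power series, but stable under products
    at once, and sufficient to continue along the segments of a ball. *)
Definition line_analytic D f : Prop :=
  forall p, D p -> forall v : splitC R, analytic0 (fun h => f (h *: v + p)).

Lemma homogZ a m (h x y : R) : homog a m (h * x) (h * y) = h ^+ m * homog a m x y.
Proof.
rewrite /homog mulr_sumr; apply: eq_bigr => i _.
have im : (i <= m)%N by rewrite -ltnS.
have -> : h ^+ m = h ^+ i * h ^+ (m - i) by rewrite -exprD subnKC.
rewrite !exprMn; ring.
Qed.

Lemma expandable_line D f : expandable D f -> line_analytic D f.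
Proof.
move=> fD p /fD[a [M [K fE]]] v; have [[M0 K0 _] _] := fE.
pose V := `|v| + 1; have V0 : 0 < V by rewrite ltr_wpDl.
have KV0 : 0 < K * V by rewrite mulr_gt0.
exists (fun m => homog a m v.1 v.2), (2 * M), (2 * (K * V)), (8^-1 / (K * V)).
split; [by rewrite mulr_ge0|by rewrite mulr_gt0|by rewrite divr_gt0|].
move=> n h hK.
have Kh : K * (V * `|h|) <= 8^-1 by rewrite mulrA mulrC -ler_pdivlMr// ltW.
have le_coord (z : R) : `|z| <= `|v| -> `|h * z| <= V * `|h|.
  move=> zv; rewrite normrM mulrC ler_wpM2r// (le_trans zv)// lerDl//.
have vx : `|v.1| <= `|v| by rewrite splitC_norm le_max lexx.
have vy : `|v.2| <= `|v| by rewrite splitC_norm le_max lexx orbT.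
have := expands_tail n fE Kh (le_coord _ vx) (le_coord _ vy).
have -> : h *: v + p = (p.1 + h * v.1, p.2 + h * v.2) by rewrite addrC.
under eq_bigr do rewrite homogZ mulrC.
by rewrite !mulrA.
Qed.

Lemma real_analytic_expandable D f : real_analytic D f -> expandable D f.
Proof. by move=> fD p Dp; exact: real_analytic_expands Dp. Qed.

Lemma expandable_d_s D f : expandable D f -> expandable D (d_s f).
Proof.
by move=> fD p /fD[a [M [K /expands_ds[_ fE]]]]; do 3 eexists; exact: fE.
Qed.

Lemma expandable_d_t D f : expandable D f -> expandable D (d_t f).
Proof.
by move=> fD p /fD[a [M [K /expands_dt[_ fE]]]]; do 3 eexists; exact: fE.
Qed.

Lemma expandable_differentiable D f p : expandable D f -> D p ->
  differentiable f p.
Proof. by move=> fD /fD[a [M [K fE]]]; exact: expands_differentiable fE. Qed.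

(** Both mixed derivatives have the constant term a 1 1. *)
Lemma expandable_schwarz D f p : expandable D f -> D p ->
  d_s (d_t f) p = d_t (d_s f) p.
Proof.
move=> fD /fD[a [M [K fE]]].
have [_ /expands_ds[_ /expands_center ->]] := expands_dt fE.
have [_ /expands_dt[_ /expands_center ->]] := expands_ds fE.
by rewrite /coef_ds /coef_dt.
Qed.

Lemma line_analytic_cst D (k : R) : line_analytic D (fun=> k).
Proof. by move=> p _ v; exact: analytic0_cst. Qed.

Lemma line_analyticD D f g : line_analytic D f -> line_analytic D g ->
  line_analytic D (fun p => f p + g p).
Proof. by move=> fD gD p Dp v; apply: analytic0D; [exact: fD|exact: gD]. Qed.

Lemma line_analyticM D f g : line_analytic D f -> line_analytic D g ->
  line_analytic D (fun p => f p * g p).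
Proof. by move=> fD gD p Dp v; apply: analytic0M; [exact: fD|exact: gD]. Qed.

Lemma line_analyticN D f : line_analytic D f -> line_analytic D (fun p => - f p).
Proof.
move=> fD; have := line_analyticM (line_analytic_cst (D := D) (-1)) fD.
by under eq_fun do rewrite mulN1r.
Qed.

Lemma line_analyticB D f g : line_analytic D f -> line_analytic D g ->
  line_analytic D (fun p => f p - g p).
Proof. by move=> fD gD; apply: line_analyticD => //; exact: line_analyticN. Qed.

Lemma ball_segment p q (x : splitC R) (e t : R) : ball q e p -> ball q e x ->
  0 <= t -> t <= 1 -> ball q e (p + t *: (x - p)).
Proof.
rewrite -ball_normE/= => pe xe t0 t1.
have -> : q - (p + t *: (x - p)) = (1 - t) *: (q - p) + t *: (q - x).
  rewrite scalerBl scale1r opprD addrA -[RHS]addrA; congr (_ + _).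
  by rewrite -!scalerN -scalerDr; congr (_ *: _); rewrite !opprB addrA subrK.
apply: (le_lt_trans (ler_normD _ _)); rewrite !normrZ !ger0_norm ?subr_ge0//.
have [->|tn0] := eqVneq t 0; first by rewrite subr0 mul1r mul0r addr0.
have tp : 0 < t by rewrite lt_neqAle eq_sym tn0.
have -> : e = (1 - t) * e + t * e by ring.
by rewrite ler_ltD ?ltr_pM2l// ler_wpM2l ?subr_ge0// ltW.
Qed.

(** The interior of the zero set is relatively closed: a ball around a point of
    its closure meets it, and each point of the ball is joined by a segment of
    the ball to a point near which f vanishes. *)
Lemma line_analytic_identity D f p0 : open D -> connected D ->
  line_analytic D f -> D p0 -> (\forall p \near p0, f p = 0) ->
  forall p, D p -> f p = 0.
Proof.
move=> oD cD fD Dp0 f0; pose Z : set (splitC R) := [set p | f p = 0].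
suff DZ : D `&` Z^° = D.
  by move=> p; rewrite -DZ => -[_ /nbhs_singleton].
apply: cD; [by exists p0|by exists Z^° => //; exact: open_interior|].
exists (closure (D `&` Z^°)); first exact: closed_closure.
apply/seteqP; split=> [p [Dp Zp]|q [Dq Zq]].
  by split => //; apply: subset_closure.
split => //; have /nbhs_ballP[e e0 qe] : nbhs q D by exact: oD.
have qe' : nbhs q (ball q e) by exact: nbhsx_ballx.
have [p [[Dp Zp] pe]] := Zq _ qe'.
suff qZ x : ball q e x -> f x = 0 by apply: filterS qe' => x; exact: qZ.
move=> xe; pose phi t := f (p + t *: (x - p)).
have -> : f x = phi 1 by rewrite /phi scale1r addrC subrK.
have /nbhs_ballP[d d0 pd] : nbhs p Z := Zp.
have n0 : 0 < `|x - p| + 1 by rewrite ltr_wpDl.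
apply: (@analytic_continuation_segment _ _ (d / (`|x - p| + 1))).
- by rewrite divr_gt0.
- move=> t t0 t1; rewrite /phi.
  under eq_fun do rewrite scalerDl addrA addrC.
  by apply: fD; apply: qe; exact: ball_segment.
- move=> t t0 td; apply: pd; rewrite -ball_normE/= opprD addrA subrr sub0r.
  rewrite normrN normrZ ger0_norm//.
  apply: (@le_lt_trans _ _ (t * (`|x - p| + 1))); last by rewrite -ltr_pdivlMr.
  by rewrite ler_wpM2l// lerDl.
Qed.

End Identity.

(** * Lorentzian algebra and the wave equation *)

Section LorentzAlgebra.
Variable A : comNzRingType.
Implicit Types u v w : 'rV[A]_3.

Lemma ldotC u v : ldot u v = ldot v u.
Proof. by apply: eq_bigr => i _; rewrite mulrAC. Qed.

Lemma ldotBl u v w : ldot (u - v) w = ldot u w - ldot v w.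
Proof. by rewrite -sumrB; apply: eq_bigr => i _; rewrite !mxE mulrBr mulrBl. Qed.

(** Used both for the embedding of the reals and for the two projections of
    the split-complex numbers onto them. *)
Lemma map_lcross (B : comNzRingType) (f : {rmorphism A -> B}) u v :
  map_mx f (lcross u v) = lcross (map_mx f u) (map_mx f v).
Proof.
apply/rowP => i; rewrite !mxE rmorphM /det3 -det_map_mx.
have -> : f (lsign A i) = lsign B i.
  by rewrite /lsign; case: ifP => _; rewrite ?rmorphN1 ?rmorph1.
congr (_ * determinant _); apply/matrixP => j k; rewrite !mxE.
by case: j => [[|[|[|//]]]] j3 /=; rewrite ?mxE// rmorph_nat.
Qed.

End LorentzAlgebra.

Lemma ldot_eq0 (K : fieldType) (u1 u2 u3 v : 'rV[K]_3) : det3 u1 u2 u3 != 0 ->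
  ldot u1 v = 0 -> ldot u2 v = 0 -> ldot u3 v = 0 -> v = 0.
Proof.
move=> d0 e1 e2 e3; set M := \matrix_(i < 3) nth 0 [:: u1; u2; u3] i.
have Mu : M \in unitmx by rewrite unitmxE unitfE.
pose v' : 'cV[K]_3 := \col_i (lsign K i * v 0 i).
have Mv : M *m v' = 0.
  apply/colP => i; rewrite !mxE.
  have E (u : 'rV[K]_3) : \sum_j u 0 j * v' j 0 = ldot u v.
    by apply: eq_bigr => j _; rewrite !mxE mulrA (mulrC (u _ _)).
  under eq_bigr do rewrite !mxE.
  case: i => [[|[|[|//]]]] i3 /=.
  - by rewrite -[RHS]e1 -E; apply: eq_bigr => j _; rewrite mxE.
  - by rewrite -[RHS]e2 -E; apply: eq_bigr => j _; rewrite mxE.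
  - by rewrite -[RHS]e3 -E; apply: eq_bigr => j _; rewrite mxE.
have v0 : v' = 0 by rewrite -(mulKmx Mu v') Mv mulmx0.
apply/rowP => i; have := congr1 (fun z : 'cV_3 => z i 0) v0; rewrite !mxE.
move=> /eqP; rewrite mulf_eq0 => /orP[|/eqP//].
by rewrite /lsign; case: ifP => _; rewrite ?oppr_eq0 oner_eq0.
Qed.

Section WaveEquation.
Variable R : realType.
Implicit Types (U : set (splitC R)) (X N : splitC R -> 'rV[R]_3).

Definition vexpandable U X : Prop := forall j, expandable U (fun p => X p 0 j).

Lemma vexpandable_derivable U X w : vexpandable U X -> U w ->
  forall v, derivable X w v.
Proof.
move=> XU Uw v; apply/derivable_mxP => i j; rewrite (ord1 i).
by apply: diff_derivable; exact: expandable_differentiable (XU j) Uw.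
Qed.

Lemma d_s_coord X w j : derivable X w (1 : splitC R) ->
  d_s X w 0 j = d_s (fun p => X p 0 j) w.
Proof. by move=> dX; have E : d_s X w = _ := derive_mx dX; rewrite E mxE. Qed.

Lemma d_t_coord X w j : derivable X w splitk ->
  d_t X w 0 j = d_t (fun p => X p 0 j) w.
Proof. by move=> dX; have E : d_t X w = _ := derive_mx dX; rewrite E mxE. Qed.

Lemma derivable_d_s U X w : open U -> vexpandable U X -> U w ->
  forall v, derivable (d_s X) w v.
Proof.
move=> oU XU Uw v; apply/derivable_mxP => i j; rewrite (ord1 i).
apply: (@near_eq_derivable _ _ _ (d_s (fun p => X p 0 j))).
  apply: filterS (oU _ Uw) => p Up; apply/esym; apply: d_s_coord.
  exact: vexpandable_derivable Up _.
apply: diff_derivable.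
exact: (expandable_differentiable (expandable_d_s (XU j)) Uw).
Qed.

Lemma derivable_d_t U X w : open U -> vexpandable U X -> U w ->
  forall v, derivable (d_t X) w v.
Proof.
move=> oU XU Uw v; apply/derivable_mxP => i j; rewrite (ord1 i).
apply: (@near_eq_derivable _ _ _ (d_t (fun p => X p 0 j))).
  apply: filterS (oU _ Uw) => p Up; apply/esym; apply: d_t_coord.
  exact: vexpandable_derivable Up _.
apply: diff_derivable.
exact: (expandable_differentiable (expandable_d_t (XU j)) Uw).
Qed.

Lemma d_s_d_s_coord U X w j : open U -> vexpandable U X -> U w ->
  d_s (d_s X) w 0 j = d_s (d_s (fun p => X p 0 j)) w.
Proof.
move=> oU XU Uw; have dX : derivable (d_s X) w (1 : splitC R) by exact: (@derivable_d_s U X w oU XU Uw _).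
apply: (etrans (d_s_coord j dX)).
apply: near_eq_derive; apply: filterS (oU _ Uw) => p Up; apply: d_s_coord.
exact: vexpandable_derivable Up _.
Qed.

Lemma d_t_d_t_coord U X w j : open U -> vexpandable U X -> U w ->
  d_t (d_t X) w 0 j = d_t (d_t (fun p => X p 0 j)) w.
Proof.
move=> oU XU Uw; have dX : derivable (d_t X) w (splitk : splitC R) by exact: (@derivable_d_t U X w oU XU Uw _).
apply: (etrans (d_t_coord j dX)).
apply: near_eq_derive; apply: filterS (oU _ Uw) => p Up; apply: d_t_coord.
exact: vexpandable_derivable Up _.
Qed.

Lemma derive_near0 U (f : splitC R -> R) w v : open U -> U w ->
  (forall p, U p -> f p = 0) -> 'D_v f w = 0.
Proof.
move=> oU Uw f0; rewrite (@near_eq_derive _ _ _ _ (fun=> 0)) ?derive_cst//.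
by apply: filterS (oU _ Uw) => p; exact: f0.
Qed.

Lemma double_sum_eq0 (x y : R) : x + x + (y + y) = 0 -> x + y = 0.
Proof. lra. Qed.

(** The hypotheses say that xtt - xss is orthogonal to n (mean curvature) and to
    xt and xs (derivatives of the conformality relations).  The three vectors
    form a basis, since det3 n xt xs is the square norm of xs. *)
Lemma frame_wave_algebra (n xt xs xss xst xtt : 'rV[R]_3) :
  lcross n xt = xs -> ldot xt xs = 0 -> ldot xs xs = - ldot xt xt ->
  0 < ldot xs xs ->
  (ldot xtt n * ldot xs xs - 2 * ldot xst n * ldot xt xs + ldot xss n * ldot xt xt) /
    (2 * (ldot xt xt * ldot xs xs - ldot xt xs ^+ 2)) = 0 ->
  ldot xt xst + ldot xs xtt = 0 -> ldot xt xss + ldot xs xst = 0 ->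
  ldot xs xss + ldot xt xst = 0 -> ldot xs xst + ldot xt xtt = 0 ->
  xss = xtt.
Proof.
move=> cNt c1 c2 c3 m0 t1 t2 t3 t4.
apply/eqP; rewrite -subr_eq0; apply/eqP; apply: (@ldot_eq0 _ n xt xs).
- by rewrite -ldot_lcross cNt gt_eqF.
- move: m0 => /eqP; rewrite c1.
  set G := ldot xs xs in c2 c3 *.
  have -> : ldot xt xt = - G by rewrite c2 opprK.
  rewrite mulf_eq0 invr_eq0 => /orP[|]; last first.
    rewrite mulf_eq0 pnatr_eq0/= expr2 mul0r subr0 mulNr oppr_eq0 mulf_eq0 orbb.
    by rewrite gt_eqF.
  rewrite mulr0 subr0 mulrN -mulrBl mulf_eq0 (gt_eqF c3) orbF => /eqP e.
  by rewrite ldotC ldotBl; lra.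
- rewrite ldotC ldotBl !(ldotC _ xt); lra.
- rewrite ldotC ldotBl !(ldotC _ xs); lra.
Qed.

Lemma is_derive_ldot X N w v : derivable X w v -> derivable N w v ->
  is_derive w v (fun p => ldot (X p) (N p))
    (ldot (X w) ('D_v N w) + ldot (N w) ('D_v X w)).
Proof.
move=> dX dN.
have coord (Y : splitC R -> 'rV[R]_3) i : derivable Y w v ->
    is_derive w v (fun p => Y p 0 i) ('D_v Y w 0 i).
  move=> dY; have E := derive_mx dY; rewrite E mxE.
  by apply: derivableP; exact: (proj1 (derivable_mxP Y w v) dY 0 i).
have dXi i := coord X i dX; have dNi i := coord N i dN.
have -> : (fun p => ldot (X p) (N p)) =
    \sum_(i < 3) (fun p => lsign R i * X p 0 i * N p 0 i).
  by apply/funext => p; rewrite fct_sumE.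
have dT i : is_derive w v (fun p => lsign R i * X p 0 i * N p 0 i)
   (lsign R i * X w 0 i * 'D_v N w 0 i + lsign R i * 'D_v X w 0 i * N w 0 i).
  have -> : (fun p => lsign R i * X p 0 i * N p 0 i) =
     lsign R i \*: ((fun p => X p 0 i) * (fun p => N p 0 i)).
    by apply/funext => p; rewrite /= !fctE /GRing.scale/= mulrA.
  apply: is_derive_eq; rewrite /GRing.scale/=; ring.
apply: is_derive_eq; rewrite (ldotC (N w)) -big_split/=.
by apply: eq_bigr => i _.
Qed.

Lemma minimal_conformal_wave U X N w : open U ->
  vexpandable U X -> conformal U X -> gauss_map U X N -> minimal U X N ->
  U w -> d_s (d_s X) w = d_t (d_t X) w.
Proof.
move=> oU XU cX [_ gN] mX Uw.
have Xs p : U p -> forall j, d_s X p 0 j = d_s (fun p => X p 0 j) p.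
  by move=> Up j; apply: d_s_coord; exact: vexpandable_derivable Up _.
have Xt p : U p -> forall j, d_t X p 0 j = d_t (fun p => X p 0 j) p.
  by move=> Up j; apply: d_t_coord; exact: vexpandable_derivable Up _.
have dXs v : derivable (d_s X) w v by exact: (@derivable_d_s U X w oU XU Uw _).
have dXt v : derivable (d_t X) w v by exact: (@derivable_d_t U X w oU XU Uw _).
have mixed : d_s (d_t X) w = d_t (d_s X) w.
  apply/rowP => j.
  apply: (etrans (d_s_coord j (dXt _))); apply/esym.
  apply: (etrans (d_t_coord j (dXs _))).
  transitivity (d_t (d_s (fun p => X p 0 j)) w).
    by apply: near_eq_derive; apply: filterS (oU _ Uw) => p Up; exact: Xs.
  transitivity (d_s (d_t (fun p => X p 0 j)) w).
    by apply/esym; exact: expandable_schwarz (XU j) Uw.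
  apply: near_eq_derive.
  by apply: filterS (oU _ Uw) => p Up; apply/esym; exact: Xt.
have [_ NXt NXs cNt cNs] := gN w Uw.
have [c1 c2 c3] := cX w Uw.
have tang v : ldot (d_t X w) ('D_v (d_s X) w) + ldot (d_s X w) ('D_v (d_t X) w) = 0.
  have dv := is_derive_ldot (dXt v) (dXs v).
  apply: (etrans (esym (@derive_val _ _ _ _ _ _ _ dv))).
  by apply: derive_near0 oU Uw _ => p /cX[].
have conf v : ldot (d_s X w) ('D_v (d_s X) w) + ldot (d_t X w) ('D_v (d_t X) w) = 0.
  have dv := is_derive_ldot (dXt v) (dXt v).
  have du := is_derive_ldot (dXs v) (dXs v).
  have H : (ldot (d_s X w) ('D_v (d_s X) w) + ldot (d_s X w) ('D_v (d_s X) w)) +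
      (ldot (d_t X w) ('D_v (d_t X) w) + ldot (d_t X w) ('D_v (d_t X) w)) = 0.
    apply: (etrans (esym (@derive_val _ _ _ _ _ _ _ (is_deriveD du dv)))).
    by apply: derive_near0 oU Uw _ => p /cX[_ E _]; rewrite fctE/= E addNr.
  exact: double_sum_eq0 H.
have t1 : ldot (d_t X w) (d_t (d_s X) w) + ldot (d_s X w) (d_t (d_t X) w) = 0.
  exact: tang.
have t2 : ldot (d_t X w) (d_s (d_s X) w) + ldot (d_s X w) (d_t (d_s X) w) = 0.
  by rewrite -mixed; exact: tang.
have t3 : ldot (d_s X w) (d_s (d_s X) w) + ldot (d_t X w) (d_t (d_s X) w) = 0.
  by rewrite -mixed; exact: conf.
have t4 : ldot (d_s X w) (d_t (d_s X) w) + ldot (d_t X w) (d_t (d_t X) w) = 0.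
  exact: conf.
have m0 := mX w Uw; rewrite /mean_curvature in m0.
exact: (frame_wave_algebra cNt c1 c2 c3 m0 t1 t2 t3 t4).
Qed.

End WaveEquation.

(** * Split-holomorphic functions in null coordinates *)

Section SplitHolomorphy.
Variable R : realType.
Implicit Types (D : set (splitC R)) (F : splitC R -> splitC R) (p : splitC R).

(** The two ring morphisms x + k'y |-> x + y and x + k'y |-> x - y, which
    identify the split-complex numbers with R * R. *)
Definition null_proj (b : bool) (z : splitC R) : R := z.1 + (-1) ^+ b * z.2.

Lemma null_proj_zmod b : zmod_morphism (null_proj b).
Proof. by move=> x y; rewrite /null_proj/=; ring. Qed.

Lemma null_proj_monoid b : monoid_morphism (null_proj b).
Proof.
split=> [|x y]; first by rewrite /null_proj/= mulr0 addr0.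
have s2 : (-1) ^+ b * (-1) ^+ b = 1 :> R by rewrite -expr2 sqrr_sign.
rewrite /null_proj/= -[x.2 * y.2]mul1r -{1}s2; ring.
Qed.

HB.instance Definition _ b :=
  GRing.isZmodMorphism.Build (splitC R) R (null_proj b) (null_proj_zmod b).
HB.instance Definition _ b :=
  GRing.isMonoidMorphism.Build (splitC R) R (null_proj b) (null_proj_monoid b).

Lemma null_proj_eq0 (z : splitC R) : (forall b, null_proj b z = 0) -> z = 0.
Proof.
case: z => x y z0; have := z0 true; have := z0 false.
rewrite /null_proj/= expr0 expr1 => e1 e2.
by congr pair; lra.
Qed.

Lemma sreal_zmod : zmod_morphism (@sreal R).
Proof. by move=> x y; congr pair; rewrite /= subrr. Qed.

Lemma sreal_monoid : monoid_morphism (@sreal R).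
Proof. by split=> // x y; congr pair; rewrite /= ?mulr0 ?mul0r addr0. Qed.

HB.instance Definition _ :=
  GRing.isZmodMorphism.Build R (splitC R) (@sreal R) sreal_zmod.
HB.instance Definition _ :=
  GRing.isMonoidMorphism.Build R (splitC R) (@sreal R) sreal_monoid.

(** Split-holomorphy only asks for partial derivatives; the power series
    provide differentiability and second derivatives. *)
Definition analytic_split D F : Prop :=
  [/\ split_holomorphic D F, expandable D (fun p => splitRe (F p)) &
      expandable D (fun p => splitIm (F p))].

(** The split Cauchy-Riemann equations say that the projection of F has zero
    derivative in the direction (s, -1), where s is the sign (-1) ^ b; the line
    through p in that direction meets the real axis at p.1 + s p.2. *)
Lemma null_proj_transport D F (b : bool) p0 (e : R) p :
  analytic_split D F -> ball p0 e `<=` D -> p0.2 = 0 -> ball p0 (e / 2) p ->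
  null_proj b (F p) = null_proj b (F (p.1 + (-1) ^+ b * p.2, 0)).
Proof.
move=> [hF uF vF] sD p02 pB; pose s : R := (-1) ^+ b.
have ss : s * s = 1 by rewrite -expr2 sqrr_sign.
have ns : `|s| = 1 by rewrite /s normrX normrN1 expr1n.
(* The null segment c leads from p at h = 0 to the real axis at h = 1. *)
pose v : splitC R := (s * p.2, - p.2).
pose c (h : R) : splitC R := h *: v + p.
have cE h : c h = (h * (s * p.2) + p.1, h * (- p.2) + p.2) by [].
have cD h : 0 <= h -> h <= 1 -> D (c h).
  move=> h0 h1; apply: sD; move: pB; rewrite -!ball_normE/= cE !splitC_norm/=.
  rewrite !gt_max p02 !sub0r !normrN => /andP[p1 p2].
  have h1' : 0 <= 1 - h by rewrite subr_ge0.
  apply/andP; split.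
    have -> : p0.1 - (h * (s * p.2) + p.1) = (p0.1 - p.1) - h * (s * p.2) by ring.
    apply: (le_lt_trans (ler_normB _ _)).
    rewrite !normrM ns mul1r ger0_norm//.
    have : h * `|p.2| <= `|p.2| by rewrite ler_piMl.
    lra.
  have -> : h * (- p.2) + p.2 = (1 - h) * p.2 by ring.
  rewrite normrM ger0_norm//.
  have : (1 - h) * `|p.2| <= `|p.2| by rewrite ler_piMl// gerBl.
  have := normr_ge0 p.2; lra.
pose g q := splitRe (F q) + s * splitIm (F q).
have dc (u : R) : is_derive u 1 c v.
  have dv : is_derive u 1 ( *:%R^~ v) v.
    apply: DeriveDef; first exact: diff_derivable.
    by rewrite deriveE// diff_val scale1r.
  have -> : c = *:%R^~ v + cst p by [].
  by apply: is_derive_eq; rewrite addr0.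
have dg (u : R) : 0 <= u -> u <= 1 -> is_derive u 1 (g \o c) 0.
  move=> u0 u1; have Dcu := cD u u0 u1.
  have [_ _ cr1 cr2] := hF _ Dcu.
  have du := is_derive_curve (expandable_differentiable uF Dcu) (dc u).
  have dv := is_derive_curve (expandable_differentiable vF Dcu) (dc u).
  have -> : g \o c = ((fun q => splitRe (F q)) \o c) +
     s \*: ((fun q => splitIm (F q)) \o c).
    by apply/funext.
  apply: is_derive_eq; rewrite /GRing.scale/= cr1 cr2.
  set x := d_t _ _; set y := d_s _ _.
  have -> : s * p.2 * x + - p.2 * y + s * (s * p.2 * y + - p.2 * x) =
     (s * s - 1) * (p.2 * y) by ring.
  by rewrite ss subrr mul0r.
have [||u] := @MVT R (g \o c) (fun=> 0) 0 1 ltr01.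
- by move=> u; rewrite in_itv/= => /andP[/ltW u0 /ltW u1]; exact: dg.
- apply: derivable_within_continuous => u; rewrite in_itv/= => /andP[u0 u1].
  by have [] := dg u u0 u1.
rewrite mul0r => _ /eqP; rewrite subr_eq0 /= => /eqP E.
transitivity (g (c 0)); first by rewrite /c scale0r add0r.
rewrite -E /g /null_proj; have -> // : c 1 = (p.1 + s * p.2, 0).
by rewrite cE !mul1r addNr addrC.
Qed.

(** The equations for the derivative come from those for F, differentiated
    in s, and from the symmetry of second derivatives. *)
Lemma analytic_split_deriv D F : open D -> analytic_split D F ->
  analytic_split D (split_deriv F).
Proof.
move=> oD [hF uF vF]; have usF := expandable_d_s uF; have vsF := expandable_d_s vF.
split; [move=> p Dp|exact: usF|exact: vsF].
split.
- by split; apply: diff_derivable; exact: expandable_differentiable usF Dp.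
- by split; apply: diff_derivable; exact: expandable_differentiable vsF Dp.
- apply: (etrans _ (expandable_schwarz vF Dp)).
  apply: near_eq_derive; apply: filterS (oD _ Dp) => q /hF[_ _ E _]; exact: E.
- apply: (etrans (esym (expandable_schwarz uF Dp))).
  apply: near_eq_derive; apply: filterS (oD _ Dp) => q /hF[_ _ _ E]; exact: E.
Qed.

Lemma d_s_sreal (f : splitC R -> R) (s : R) :
  d_s f (sreal s) = 'D_1 (f \o @sreal R) s.
Proof.
suff E : (fun h : R => h^-1 *: ((f \o shift (sreal s)) (h *: (1 : splitC R))
      - f (sreal s))) =
    (fun h : R => h^-1 *: ((f \o @sreal R \o shift s) (h *: (1 : R))
      - (f \o @sreal R) s)) by rewrite /d_s /derive E.
apply/funext => h /=; rewrite scale_split1 [h *: 1]mulr1.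
by have -> : (h, 0) + sreal s = sreal (h + s) by congr pair; exact: addr0.
Qed.

End SplitHolomorphy.

Section LineAnalyticCross.
Variable R : realType.
Implicit Types (D : set (splitC R)).

Lemma line_analytic_sum D (I : Type) (r : seq I) (f : I -> splitC R -> R) :
  (forall i, line_analytic D (f i)) ->
  line_analytic D (fun p => \sum_(i <- r) f i p).
Proof.
move=> fD; elim: r => [|i r IH].
  under eq_fun do rewrite big_nil.
  exact: line_analytic_cst.
under eq_fun do rewrite big_cons.
exact: line_analyticD (fD i) IH.
Qed.

Lemma line_analytic_prod D (I : Type) (r : seq I) (f : I -> splitC R -> R) :
  (forall i, line_analytic D (f i)) ->
  line_analytic D (fun p => \prod_(i <- r) f i p).
Proof.
move=> fD; elim: r => [|i r IH].
  under eq_fun do rewrite big_nil.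
  exact: line_analytic_cst.
under eq_fun do rewrite big_cons.
exact: line_analyticM (fD i) IH.
Qed.

Lemma line_analytic_lcross D (u v : splitC R -> 'rV[R]_3) :
  (forall j, line_analytic D (fun p => u p 0 j)) ->
  (forall j, line_analytic D (fun p => v p 0 j)) ->
  forall j, line_analytic D (fun p => lcross (u p) (v p) 0 j).
Proof.
move=> uD vD j.
have detE : (fun p => lcross (u p) (v p) 0 j) =
    (fun p => lsign R j * \sum_(s : 'S_3) (-1) ^+ s *
       \prod_(i < 3) nth 0 [:: u p; v p; delta_mx 0 j] i 0 (s i)).
  apply/funext => p; rewrite mxE /det3 /determinant; congr (_ * _).
  by apply: eq_bigr => s _; congr (_ * _); apply: eq_bigr => i _; rewrite mxE.
rewrite detE; apply: line_analyticM; first exact: line_analytic_cst.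
apply: line_analytic_sum => s; apply: line_analyticM; first exact: line_analytic_cst.
apply: line_analytic_prod => i.
case: i => [[|[|[|//]]]] i3 /=; [exact: uD|exact: vD|exact: line_analytic_cst].
Qed.

End LineAnalyticCross.

(** * The split-holomorphic derivative of a minimal surface *)

Section BjorlingDerivative.
Variable R : realType.
Implicit Types (D : set (splitC R)) (F : splitC R -> splitC R) (p : splitC R).

Lemma line_analytic_null_proj D F b : expandable D (fun p => splitRe (F p)) ->
  expandable D (fun p => splitIm (F p)) ->
  line_analytic D (fun p => null_proj b (F p)).
Proof.
move=> uF vF; apply: line_analyticD; first exact: expandable_line uF.
apply: line_analyticM; first exact: line_analytic_cst.
exact: expandable_line vF.
Qed.

(** F is not required to be split-holomorphic: it is enough that each null
    projection of F p depends only on the point where the null line through p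
    meets the real axis, a property inherited by polynomial expressions. *)
Lemma split_identity D (s1 e : R) (F : splitC R -> 'rV[splitC R]_3) :
  open D -> connected D -> 0 < e -> D (sreal s1) ->
  (forall b j, line_analytic D (fun p => null_proj b (F p 0 j))) ->
  (forall b p, ball (sreal s1) (e / 2) p ->
     map_mx (null_proj b) (F p) =
     map_mx (null_proj b) (F (sreal (p.1 + (-1) ^+ b * p.2)))) ->
  (forall s, `|s1 - s| < e -> F (sreal s) = 0) ->
  forall p, D p -> F p = 0.
Proof.
move=> oD cD e0 Ds1 FD Ft F0 p Dp; apply/rowP => j; rewrite mxE.
apply: null_proj_eq0 => b.
apply: (line_analytic_identity oD cD (FD b j) Ds1 _ Dp).
have e2 : 0 < e / 2 by rewrite divr_gt0.
have := nbhsx_ballx (sreal s1 : splitC R) _ e2; apply: filterS => q qB.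
have -> : null_proj b (F q 0 j) = map_mx (null_proj b) (F q) 0 j by rewrite mxE.
rewrite Ft// F0; first by rewrite !mxE rmorph0.
move: qB; rewrite -ball_normE/= splitC_norm/= gt_max sub0r normrN => /andP[q1 q2].
have -> : s1 - (q.1 + (-1) ^+ b * q.2) = s1 - q.1 - (-1) ^+ b * q.2 by ring.
apply: (le_lt_trans (ler_normB _ _)).
rewrite normrM normrX normrN1 expr1n mul1r; lra.
Qed.

(** Phi - gam' - k' (W x gam') is built from split-holomorphic functions by
    operations that commute with the null projections, and it vanishes on the
    real axis because N x X_s = X_t there. *)
Lemma bjorling_derivative D (s1 e : R) (X N : splitC R -> 'rV[R]_3)
    (gam W : splitC R -> 'rV[splitC R]_3) :
  let Phi p := \row_j ((d_s (fun z => X z 0 j) p, d_t (fun z => X z 0 j) p)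
                       : splitC R) in
  open D -> connected D -> 0 < e -> ball (sreal s1) e `<=` D ->
  (forall j, analytic_split D (fun p => Phi p 0 j)) ->
  (forall j, analytic_split D (fun p => gam p 0 j)) ->
  (forall j, analytic_split D (fun p => W p 0 j)) ->
  (forall s, `|s1 - s| < e -> gam (sreal s) = map_mx (@sreal R) (X (sreal s))) ->
  (forall s, `|s1 - s| < e -> W (sreal s) = map_mx (@sreal R) (N (sreal s))) ->
  (forall p, D p -> lcross (N p) (\row_j d_s (fun z => X z 0 j) p) =
                    \row_j d_t (fun z => X z 0 j) p) ->
  forall p, D p -> Phi p = split_deriv_vec gam p
                           + splitk *: lcross (W p) (split_deriv_vec gam p).
Proof.
move=> Phi oD cD e0 sD hP hg hW gE WE NX p Dp.
have e2e : e / 2 <= e by lra.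
have Ds1 : D (sreal s1) by apply: sD; exact: ballxx.
have hdg j : analytic_split D (fun p => split_deriv_vec gam p 0 j).
  have := analytic_split_deriv oD (hg j).
  have -> // : split_deriv (fun z => gam z 0 j) = (fun p => split_deriv_vec gam p 0 j).
  by apply/funext => q; rewrite mxE.
pose F q := Phi q - split_deriv_vec gam q
              - splitk *: lcross (W q) (split_deriv_vec gam q).
suff F0 : F p = 0.
  by apply/eqP; rewrite -subr_eq0 opprD addrA -/(F p) F0.
have projF b q : map_mx (null_proj b) (F q) =
   map_mx (null_proj b) (Phi q) - map_mx (null_proj b) (split_deriv_vec gam q)
   - (-1) ^+ b *: lcross (map_mx (null_proj b) (W q))
       (map_mx (null_proj b) (split_deriv_vec gam q)).
  have pk : null_proj b (splitk : splitC R) = (-1) ^+ b.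
    by rewrite /null_proj/= mulr1 add0r.
  by rewrite /F !map_mxB map_mxZ map_lcross -pk.
apply: (@split_identity D s1 e F oD cD e0 Ds1 _ _ _ p Dp) => [b j|b q qB|s se].
- have -> : (fun p => null_proj b (F p 0 j)) = (fun p =>
     null_proj b (Phi p 0 j) - null_proj b (split_deriv_vec gam p 0 j)
     - (-1) ^+ b * lcross (map_mx (null_proj b) (W p))
         (map_mx (null_proj b) (split_deriv_vec gam p)) 0 j).
    apply/funext => q; have := congr1 (fun M : 'rV_3 => M 0 j) (projF b q).
    by rewrite [LHS]mxE => ->; rewrite !mxE.
  have lin (G : splitC R -> 'rV[splitC R]_3) : (forall j, analytic_split D (fun p => G p 0 j)) ->
      forall j, line_analytic D (fun p => map_mx (null_proj b) (G p) 0 j).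
    move=> hG k; have [_ uG vG] := hG k.
    by under eq_fun do rewrite mxE; exact: line_analytic_null_proj uG vG.
  have lin' (G : splitC R -> 'rV[splitC R]_3) :
      (forall j, analytic_split D (fun p => G p 0 j)) ->
      line_analytic D (fun p => null_proj b (G p 0 j)).
    by move=> hG; have [_ uG vG] := hG j; exact: line_analytic_null_proj uG vG.
  apply: line_analyticB; first by apply: line_analyticB; exact: lin'.
  apply: line_analyticM; first exact: line_analytic_cst.
  by apply: line_analytic_lcross; exact: lin.
- have tr (G : splitC R -> 'rV[splitC R]_3) :
      (forall j, analytic_split D (fun p => G p 0 j)) ->
      map_mx (null_proj b) (G q) =
      map_mx (null_proj b) (G (sreal (q.1 + (-1) ^+ b * q.2))).
    move=> hG; apply/rowP => j; rewrite !mxE.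
    exact: (null_proj_transport b (hG j) sD _ qB).
  apply: (etrans (projF b q)); apply: (etrans _ (esym (projF b _))).
  have comb (k : R) (x x' y y' z z' : 'rV[R]_3) : x = x' -> y = y' -> z = z' ->
    x - y - k *: lcross z y = x' - y' - k *: lcross z' y' by move=> -> -> ->.
  exact: (comb _ _ _ _ _ _ _ (tr _ hP) (tr _ hdg) (tr _ hW)).
- have near_s : \forall s' \near s, `|s1 - s'| < e.
    have es : 0 < e - `|s1 - s| by rewrite subr_gt0.
    have := nbhsx_ballx (s : R) _ es; apply: filterS => s'; rewrite -ball_normE/= => ss'.
    have -> : s1 - s' = (s1 - s) + (s - s') by ring.
    by apply: (le_lt_trans (ler_normD _ _)); lra.
  have Dgam : split_deriv_vec gam (sreal s) =
     map_mx (@sreal R) (\row_j d_s (fun z => X z 0 j) (sreal s)).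
    apply/rowP => j; rewrite !mxE /split_deriv /sreal; congr pair.
      rewrite -!/(sreal _) !d_s_sreal; apply: near_eq_derive.
      by apply: filterS near_s => s' /gE /= ->; rewrite mxE.
    rewrite -!/(sreal _) d_s_sreal -(derive_cst (0 : R) s 1); apply: near_eq_derive.
    by apply: filterS near_s => s' /gE /= ->; rewrite mxE.
  have Ds : D (sreal s).
    by apply: sD; rewrite -ball_normE/= splitC_norm/= subrr normr0 gt_max se e0.
  rewrite /F Dgam WE// -map_lcross NX//.
  apply/rowP => j; rewrite !mxE /sreal; congr pair; rewrite /=; ring.
Qed.

End BjorlingDerivative.

(** * Line integrals of exact forms *)

Section PathIntegral.
Variable R : realType.
Notation mu := (@lebesgue_measure R).

Lemma integrable_disjointU d (T : measurableType d) (nu : {measure set T -> \bar R})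
    (A B : set T) (f : T -> \bar R) : measurable A -> measurable B ->
  [disjoint A & B] -> nu.-integrable A f -> nu.-integrable B f ->
  nu.-integrable (A `|` B) f.
Proof.
move=> mA mB AB /integrableP[mfA fA] /integrableP[mfB fB].
have mfAB := (measurable_funU f mA mB).2 (conj mfA mfB).
apply/integrableP; split => //.
rewrite ge0_integral_setU//; first exact: lte_add_pinfty.
exact: measurableT_comp.
Qed.

(** A path need not be differentiable at its break points, so the integrand is
    known in the interior of each arc only; end points have measure zero. *)
Lemma integral_eq_interior (x y v : R) (f g : R -> R) :
  {in `]x, y[, f =1 g} -> mu.-integrable `[x, y] (EFin \o g) ->
  (\int[mu]_(u in `[x, y]) (g u)%:E = v%:E)%E ->
  mu.-integrable `[x, y] (EFin \o f) /\ \int[mu]_(u in `[x, y]) f u = v.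
Proof.
move=> fg ig vE.
have sub : `]x, y[%classic `<=` `[x, y]%classic.
  exact: subset_itv_oo_cc.
have mg : measurable_fun `]x, y[ g.
  have /measurable_EFinP := measurable_int _ ig.
  exact: measurable_funS.
have mf : measurable_fun `]x, y[ f.
  apply: (eq_measurable_fun g) => // u; rewrite inE/= => uxy; exact/esym/fg.
split.
  apply/integrableP; split.
    by apply/measurable_EFinP; exact: measurable_fun_itv_cc mf.
  have /integrableP[_] := ig.
  rewrite -(@eq_integral_itv_bounded _ _ _ (fun u => `|f u|) (fun u => `|g u|)).
  - by [].
  - exact: measurableT_comp.
  - exact: measurableT_comp.
  - by move=> u uxy; rewrite fg.
by rewrite /Rintegral (eq_integral_itv_bounded _ _ mf mg fg) vE.
Qed.

(** The pullback of dY along the path c. *)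
Definition path_form (Y : splitC R -> R) (c : R -> splitC R) (u : R) : R :=
  (derive1 c u).1 * d_s Y (c u) + (derive1 c u).2 * d_t Y (c u).

Definition C1_on (D : set (splitC R)) (Y : splitC R -> R) : Prop :=
  forall p, D p -> [/\ differentiable Y p, {for p, continuous (d_s Y)} &
                       {for p, continuous (d_t Y)}].

Lemma arc_integral D Y (x y : R) (c : R -> splitC R) : open D -> C1_on D Y ->
  x < y -> C1_arc x y c -> (forall u, u \in `[x, y] -> D (c u)) ->
  mu.-integrable `[x, y] (EFin \o path_form Y c) /\
  \int[mu]_(u in `[x, y]) path_form Y c u = Y (c y) - Y (c x).
Proof.
move=> oD YD xy [g [dg cg gc]] cD.
have gD u : u \in `[x, y] -> D (g u) by move=> uxy; rewrite -gc//; exact: cD.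
have xin : x \in `[x, y] by rewrite in_itv/= lexx ltW.
have yin : y \in `[x, y] by rewrite in_itv/= lexx ltW.
have cg0 : continuous g.
  by move=> u; apply/differentiable_continuous/derivable1_diffP; exact: dg.
have dYg u : u \in `[x, y] -> is_derive u 1 (Y \o g) (path_form Y g u).
  move=> uxy; have [dY _ _] := YD _ (gD _ uxy); rewrite /path_form derive1E.
  by apply: is_derive_curve => //; exact: derivableP.
have cform u : u \in `[x, y] -> {for u, continuous (path_form Y g)}.
  move=> uxy; have [_ cs ct] := YD _ (gD _ uxy).
  apply: cvgD; apply: cvgM.
  - apply: (cvg_comp (derive1 g) fst); [exact: cg|exact: cvg_fst].
  - exact: (cvg_comp g (d_s Y) (cg0 u) cs).
  - apply: (cvg_comp (derive1 g) snd); [exact: cg|exact: cvg_snd].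
  - exact: (cvg_comp g (d_t Y) (cg0 u) ct).
have cwithin : {within `[x, y], continuous (path_form Y g)}.
  by apply: continuous_in_subspaceT => u; rewrite inE/= => uxy; exact: cform.
have eqform : {in `]x, y[, path_form Y c =1 path_form Y g}.
  move=> u uxy; have uxy' := subset_itv_oo_cc uxy.
  have e1 : c u = g u := gc u uxy'.
  have e2 : derive1 c u = derive1 g u.
    rewrite !derive1E; apply: near_eq_derive.
    apply: filterS (near_in_itvoo uxy) => z zxy; apply: gc.
    exact: subset_itv_oo_cc zxy.
  by rewrite /path_form e1 e2.
have ig : mu.-integrable `[x, y] (EFin \o path_form Y g).
  by apply: continuous_compact_integrable => //; exact: segment_compact.
have cYg u : u \in `[x, y] -> {for u, continuous (Y \o g)}.
  move=> /dYg[dd _]; exact/differentiable_continuous/derivable1_diffP.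
apply: (integral_eq_interior eqform ig).
rewrite (@continuous_FTC2 _ _ (Y \o g) _ _ xy cwithin).
- by rewrite /= -!gc.
- split.
  + by move=> u uxy; have [] := dYg u (subset_itv_oo_cc uxy).
  + exact: cvg_at_right_filter (cYg _ xin).
  + exact: cvg_at_left_filter (cYg _ yin).
- move=> u uxy; rewrite derive1E.
  by have [_ ->] := dYg u (subset_itv_oo_cc uxy).
Qed.

(** Additivity of the integral makes the boundary terms telescope. *)
Lemma partition_integral D Y (c : R -> splitC R) s a : open D -> C1_on D Y ->
  path <%O a s ->
  (forall i, (i < size s)%N -> C1_arc (nth a (a :: s) i) (nth a (a :: s) i.+1) c) ->
  (forall u, u \in `[a, last a s] -> D (c u)) ->
  mu.-integrable `[a, last a s] (EFin \o path_form Y c) /\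
  \int[mu]_(u in `[a, last a s]) path_form Y c u = Y (c (last a s)) - Y (c a).
Proof.
move=> oD YD; elim: s a => [|x s IH] a /=.
  (* The interior of [a, a] is empty, so the integrand agrees there with 0. *)
  move=> _ _ _; apply: (@integral_eq_interior _ _ _ _ (cst 0)).
  - by move=> u; rewrite in_itv/= => /andP[au ua]; have := lt_trans au ua; rewrite ltxx.
  - exact: integrable0.
  - by rewrite subrr integral0.
move=> /andP[ax xs] arcs sD.
have xl : x <= last x s by apply: (@itv_partition_le _ _ x (last x s) s); split.
have [i1 e1] : mu.-integrable `[a, x] (EFin \o path_form Y c) /\
    \int[mu]_(u in `[a, x]) path_form Y c u = Y (c x) - Y (c a).
  apply: (arc_integral oD YD ax); first exact: (arcs 0%N).
  move=> u; rewrite in_itv/= => /andP[au ux]; apply: sD.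
  by rewrite in_itv/= au (le_trans ux).
have [i2 e2] : mu.-integrable `[x, last x s] (EFin \o path_form Y c) /\
    \int[mu]_(u in `[x, last x s]) path_form Y c u = Y (c (last x s)) - Y (c x).
  apply: IH; [exact: xs|move=> i si|move=> u].
    have := arcs i.+1 si; rewrite /= (set_nth_default x a)//; last exact: ltnW.
    by rewrite (set_nth_default x a).
  rewrite in_itv/= => /andP[xu ul]; apply: sD.
  by rewrite in_itv/= ul andbT (le_trans _ xu)// ltW.
have i2' : mu.-integrable `]x, last x s] (EFin \o path_form Y c).
  by apply: integrableS i2 => //; exact: subset_itv_oc_cc.
have split_itv : `[a, last x s]%classic = `[a, x] `|` `]x, last x s].
  by rewrite (@itv_bndbnd_setU _ _ (BLeft a) (BRight x))//; rewrite bnd_simp// ltW.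
have disj : [disjoint `[a, x]%classic & `]x, last x s]%classic].
  apply/disj_setPS => u [] /=; rewrite !in_itv/= => /andP[_ ux] /andP[xu _].
  by have := le_lt_trans ux xu; rewrite ltxx.
have i12 : mu.-integrable `[a, last x s] (EFin \o path_form Y c).
  by rewrite split_itv; apply: integrable_disjointU.
split=> //; rewrite split_itv Rintegral_setU//; last by rewrite -split_itv.
by rewrite e1 Rintegral_itv_obnd_cbnd// e2; ring.
Qed.

End PathIntegral.

(** * The spacelike Bjorling representation *)

Section C1.
Variable R : realType.
Implicit Types (D : set (splitC R)) (f g : splitC R -> R).

Lemma expandable_C1 D f : expandable D f -> C1_on D f.
Proof.
move=> fD p Dp; split; first exact: expandable_differentiable fD Dp.
  apply: differentiable_continuous.
  exact: expandable_differentiable (expandable_d_s fD) Dp.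
apply: differentiable_continuous.
exact: expandable_differentiable (expandable_d_t fD) Dp.
Qed.

Lemma derive_C1_onB D f g (v : splitC R) p : C1_on D f -> C1_on D g -> D p ->
  'D_v (fun q => f q - g q) p = 'D_v f p - 'D_v g p.
Proof.
move=> fD gD Dp; have [df _ _] := fD p Dp; have [dg _ _] := gD p Dp.
by apply: deriveB; exact: diff_derivable.
Qed.

Lemma near_eq_continuous (f g : splitC R -> R) p :
  (\forall q \near p, f q = g q) -> {for p, continuous f} -> {for p, continuous g}.
Proof.
move=> fg cf; rewrite /prop_for /continuous_at -(nbhs_singleton fg).
by apply: cvg_trans cf; apply: near_eq_cvg; apply: filterS fg => q ->.
Qed.

Lemma C1_onB D f g : open D -> C1_on D f -> C1_on D g ->
  C1_on D (fun p => f p - g p).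
Proof.
move=> oD fD gD p Dp; have [df fs ft] := fD p Dp; have [dg gs gt] := gD p Dp.
split; first exact: differentiableB.
  apply: (@near_eq_continuous (fun q => d_s f q - d_s g q)).
    apply: filterS (oD _ Dp) => q Dq; apply/esym; exact: derive_C1_onB fD gD Dq.
  exact: (cvgB fs gs).
apply: (@near_eq_continuous (fun q => d_t f q - d_t g q)).
  apply: filterS (oD _ Dp) => q Dq; apply/esym; exact: derive_C1_onB fD gD Dq.
exact: (cvgB ft gt).
Qed.

(** The end points of I may belong to it, so a ball is only available around an
    inner point such as the midpoint. *)
Lemma interval_inner_ball (I : set R) D : nondegenerate_interval I -> open D ->
  (forall s, I s -> D (sreal s)) ->
  exists s1 e, [/\ 0 < e, ball (sreal s1) e `<=` D & forall s, `|s1 - s| < e -> I s].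
Proof.
move=> [iI [a [b [Ia Ib ab]]]] oD ID; pose s1 := (a + b) / 2.
have Is s : a <= s -> s <= b -> I s by move=> as_ sb; apply: (iI a b) => //; rewrite as_.
have Ds1 : D (sreal s1) by apply: ID; apply: Is; rewrite /s1; lra.
have /nbhs_ballP[e e0 eD] : nbhs (sreal s1 : splitC R) D by exact: oD.
have ba : 0 < (b - a) / 2 by lra.
exists s1, (Num.min e ((b - a) / 2)); split.
- by rewrite lt_min; apply/andP; split.
- by apply: subset_trans eD; apply: le_ball; rewrite ge_min lexx.
- move=> s; rewrite lt_min => /andP[_]; rewrite ltr_norml /s1 => /andP[h1 h2].
  by apply: Is; lra.
Qed.

(** The two split Cauchy-Riemann equations for X_s + k' X_t are the wave
    equation and the symmetry of second derivatives. *)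
Lemma surface_analytic_split (U : set (splitC R)) (X N : splitC R -> 'rV[R]_3) j :
  open U -> vexpandable U X -> conformal U X -> gauss_map U X N -> minimal U X N ->
  analytic_split U (fun p => ((d_s (fun z => X z 0 j) p, d_t (fun z => X z 0 j) p)
                       : splitC R)).
Proof.
move=> oU XU cX gN mX.
have es := expandable_d_s (XU j); have et := expandable_d_t (XU j).
split; [move=> p Up|exact: es|exact: et]; split.
- by split; apply: diff_derivable; exact: expandable_differentiable es Up.
- by split; apply: diff_derivable; exact: expandable_differentiable et Up.
- apply: (etrans (esym (d_s_d_s_coord j oU XU Up))).
  apply: (etrans _ (d_t_d_t_coord j oU XU Up)).
  by rewrite (minimal_conformal_wave oU XU cX gN mX Up).
- exact/esym/(expandable_schwarz (XU j) Up).
Qed.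

Lemma analytic_splitS (U D : set (splitC R)) F : D `<=` U ->
  analytic_split U F -> analytic_split D F.
Proof.
move=> DU [h u v]; split; [move=> p Dp|move=> p /DU; exact: u|move=> p /DU; exact: v].
exact: h (DU _ Dp).
Qed.

Lemma split_extension_analytic (I : set R) D (c : R -> 'rV[R]_3) F j :
  split_extension I D c F -> analytic_split D (fun p => F p 0 j).
Proof.
move=> [_ hF aF]; have [u v] := aF j; split; first exact: hF.
  exact: real_analytic_expandable u.
exact: real_analytic_expandable v.
Qed.

End C1.

Theorem theorem3p3 (R : realType)
  (U : set (splitC R)) (X N : splitC R -> 'rV[R]_3)
  (hX : timelike_surface U X) (hconf : conformal U X)
  (hN : gauss_map U X N) (hmin : minimal U X N)
  (I : set R) (hI : nondegenerate_interval I)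
  (hIU : forall s, I s -> U (sreal s))
  (gamma W : R -> 'rV[R]_3)
  (hgamma : forall s, I s -> gamma s = X (sreal s))
  (hW : forall s, I s -> W s = N (sreal s))
  (D : set (splitC R)) (hD : simply_connected_region D)
  (hDU : D `<=` U) (hID : forall s, I s -> D (sreal s))
  (gammaC WC : splitC R -> 'rV[splitC R]_3)
  (hgammaC : split_extension I D gamma gammaC)
  (hWC : split_extension I D W WC)
  (s0 : R) (hs0 : I s0)
  (w : splitC R) (hw : D w)
  (a b : R) (c : R -> splitC R) (hc : path_in D a b c (sreal s0) w) :
  X w = map_mx (@splitRe R)
    (gammaC w + splitk *: line_integral_vec a b c
       (fun z => lcross (WC z) (split_deriv_vec gammaC z))).
Proof.
have [[_ oU _] XA _] := hX.
have XU : vexpandable U X by move=> j; exact: real_analytic_expandable (XA j).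
have [[_ oD cD] _] := hD.
have [s1 [e [e0 eD eI]]] := interval_inner_ball hI oD hID.
have gE s : I s -> gammaC (sreal s) = map_mx (@sreal R) (X (sreal s)).
  by move=> Is; rewrite -hgamma//; have [E _ _] := hgammaC; exact: E.
have WE s : I s -> WC (sreal s) = map_mx (@sreal R) (N (sreal s)).
  by move=> Is; rewrite -hW//; have [E _ _] := hWC; exact: E.
pose P z := lcross (WC z) (split_deriv_vec gammaC z).
have gA j := split_extension_analytic j hgammaC.
have key : forall p, D p ->
    \row_j ((d_s (fun z => X z 0 j) p, d_t (fun z => X z 0 j) p) : splitC R) =
    split_deriv_vec gammaC p + splitk *: P p.
  apply: (bjorling_derivative (N := N) oD cD e0 eD _ gA).
  - move=> j; under eq_fun do rewrite mxE.
    apply: (analytic_splitS hDU).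
    exact: surface_analytic_split j oU XU hconf hN hmin.
  - move=> j; exact: split_extension_analytic hWC.
  - by move=> s se; apply: gE; exact: eI.
  - by move=> s se; apply: WE; exact: eI.
  - move=> p /hDU Up; have [_ /(_ p Up)[_ _ _ _ NX]] := hN.
    have -> : \row_j d_s (fun z => X z 0 j) p = d_s X p.
      apply/rowP => j; rewrite mxE; apply/esym; apply: d_s_coord.
      exact: vexpandable_derivable Up _.
    rewrite NX; apply/rowP => j; rewrite mxE; apply: d_t_coord.
    exact: vexpandable_derivable Up _.
have [[ab [s [[ps /eqP ls] arcs]]] cD' ca cb] := hc.
apply/rowP => j; rewrite 3!mxE.
pose u z := splitRe (gammaC z 0 j); pose x z := X z 0 j.
have [hg gu _] := gA j.
have xC : C1_on D x by apply: expandable_C1 => p /hDU; exact: XU.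
have uC : C1_on D u by exact: expandable_C1 gu.
(* The differential of Y is Re (k' P dw), and Y vanishes at s0. *)
pose Y z := x z - u z.
have YC : C1_on D Y by exact: C1_onB.
have Ys p : D p -> d_s Y p = splitIm (P p 0 j).
  move=> Dp; apply: (etrans (derive_C1_onB _ xC uC Dp)).
  have := congr1 (fun M : 'rV[splitC R]_3 => (M 0 j).1) (key p Dp).
  by rewrite !mxE /= => E; rewrite -/(d_s x p) -/(d_s u p) /x E mul0r mul1r add0r addrAC subrr add0r.
have Yt p : D p -> d_t Y p = splitRe (P p 0 j).
  move=> Dp; apply: (etrans (derive_C1_onB _ xC uC Dp)).
  have := congr1 (fun M : 'rV[splitC R]_3 => (M 0 j).2) (key p Dp).
  have [_ _ _ ut] := hg p Dp.
  rewrite !mxE /= => E; rewrite -/(d_t x p) -/(d_t u p) /x E ut.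
  by rewrite mul0r mul1r add0r addrAC subrr add0r.
have [|_ intE] := partition_integral oD YC ps arcs.
  by rewrite ls.
move: intE; rewrite ls ca cb => intE.
have LE : splitIm (line_integral a b c (fun z => P z 0 j)) = Y w - Y (sreal s0).
  rewrite -intE /line_integral/=; apply: eq_Rintegral => t; rewrite inE/= => tab.
  have Dt := cD' t tab; rewrite /path_form Ys// Yt// /splitIm/=.
  by rewrite addrC /splitRe; congr (_ + _); rewrite mulrC.
have Y0 : Y (sreal s0) = 0 by rewrite /Y /u gE// !mxE subrr.
rewrite Y0 subr0 in LE.
have ReE (z L : splitC R) : splitRe (z + splitk * L) = splitRe z + splitIm L.
  by rewrite /splitRe /splitIm/= mul0r mul1r add0r.
rewrite ReE mxE LE /Y /x /u.
by rewrite addrC subrK.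
Qed.
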